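(* For every integer $L\ge 1$ there exist constants $C_1(L),C_2(L)>0$ depending only on $L$ such that the following holds. Let $K\ge 2$, $1\le K_0\le K$ and $N>K_0$ be integers, and consider a constrained best mixed arm identification instance with $K$ arms (of which the first $K_0$ are unknown), $L$ costs and sampling budget $N$, whose linear program $\max\{\mu^T\mathbf{x}:\mathbf{A}\mathbf{x}=\mathbf{b},\ \mathbf{x}\ge 0\}$ has a unique optimal solution $\mathbf{x}^*$, and this $\mathbf{x}^*$ has exactly $L+1$ non-zero coordinates. Let $\mathcal{I}^*=\mathrm{supp}(\mathbf{x}^* )$, and let $\mathcal{X}^{\mathrm{SFSR}}$ denote the output of the Score Function-based Successive Reject (SFSR) algorithm with the intersection value score. Then $$\mathbb{P}\big(\mathcal{X}^{\mathrm{SFSR}}\neq\mathcal{I}^*\big)\le C_1(L)\,K\,\exp\!\left(-\frac{\tilde N\,\Delta_0^2}{K}\right)+C_2(L)\,K^{L+2}\,\exp\!\left(-\min_{2\le i\le K}\frac{\tilde N\,\Delta_{(i+L)}^2}{i}\right),$$ where $\tilde N:=\dfrac{N-K_0}{3\left(\frac{L+1}{2}+\log K_0\right)}$.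
   Context: **Problem.** There are $K$ arms $[K]=\{1,\dots,K\}$ and $L$ types of cost. Each pull of arm $a$ yields a reward distributed as $\mathcal{N}(r_a,\sigma_r^2)$ and costs distributed as $\mathcal{N}(c_{l,a},\sigma_c^2)$, $l\in[L]$ ($\sigma_r,\sigma_c>0$); all random rewards and costs (across arms, pulls and cost types) are mutually independent. The means $r_a,c_{l,a}$ are unknown for $a\le K_0$ and known for $K_0<a\le K$. A cost bound $\bar c\in\mathbb{R}^L$ is given. With $\mathbf{r}=(r_a)_{a\in[K]}$ and $\mathbf{c}=(c_{l,a})_{l\in[L],a\in[K]}$, the problem of interest is to maximize $\mathbf{r}^Tp$ over probability vectors $p\in\mathbb{R}^K_+$ with $\mathbf{c}p\le\bar c$. Adding slack variables $s\in\mathbb{R}_+^L$, put $$\mathbf{x}=\begin{pmatrix}p\\ s\end{pmatrix},\quad \mu=\begin{pmatrix}\mathbf{r}\\ \mathbf{0}_L\end{pmatrix},\quad \mathbf{A}=\begin{pmatrix}\mathbf{c}&\mathbf{I}_{L\times L}\\ \mathbf{1}_K^T&\mathbf{0}_L^T\end{pmatrix}\in\mathbb{R}^{(L+1)\times(K+L)},\quad \mathbf{b}=\begin{pmatrix}\bar c\\1\end{pmatrix},$$ so the problem becomes the linear program $\max\{\mu^T\mathbf{x}:\mathbf{A}\mathbf{x}=\mathbf{b},\mathbf{x}\ge0\}$. Indices $K+1,\dots,K+L$ (slack variables) are called virtual arms. For a vector $v$ or matrix $M$ and index set $\mathcal{I}$, $v_{\mathcal{I}}$ is the subvector and $M_{\mathcal{I}}$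 the submatrix of columns indexed by $\mathcal{I}$. **Basic feasible solutions.** A basis is a set of column indices of cardinality $L+1$. A non-negative vector $\mathbf{x}$ is a basic feasible solution (BFS) of $(\mathbf{A},\mathbf{b})$ corresponding to the basis $\mathcal{I}$ if $\mathbf{x}_i=0$ for $i\notin\mathcal{I}$, $\mathbf{A}_{\mathcal{I}}$ is invertible, and $\mathbf{x}_{\mathcal{I}}=\mathbf{A}_{\mathcal{I}}^{-1}\mathbf{b}\ge0$. **Modified instances.** For $\tilde{\mathbf{r}}\in\mathbb{R}^{K_0}$, $\tilde{\mathbf{c}}\in\mathbb{R}^{L\times K_0}$, let $\tilde\mu$ and $\tilde{\mathbf{A}}$ be obtained from $\mu$ and $\mathbf{A}$ by replacing $\mu_a=r_a$ by $\tilde r_a$ and $\mathbf{A}_{l,a}=c_{l,a}$ by $\tilde c_{l,a}$ for $a\le K_0$, $l\le L$; define $\hat\mu,\hat{\mathbf{A}}$ in the same way from empirical means $\hat{\mathbf{r}},\hat{\mathbf{c}}$. **SFSR algorithm.** Let $\Psi(K_0,L)=\sum_{j=1}^{K_0}\frac{1}{\max(2,j-L)}$, $n_0=0$, $n_k=\left\lceil\frac{1}{\Psi(K_0,L)}\frac{N-K_0}{K+1-k}\right\rceil$ and $T_k=n_k-n_{k-1}$ for $k\in[K-1]$. Start with $\mathcal{X}=[K+L]$. For $k=1,\dots,K-1$: pull each arm in $\mathcal{X}\cap[K_0]$ $T_k$ times; update the empirical mean rewards $\hat r_a$ and costs $\hat c_{l,a}$ (over all pulls so far) of the arms in $\mathcal{X}\cap[K_0]$;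 for each $a\in\mathcal{X}$ compute the intersection value score $$\hat\rho_a^k=\max\{\hat\mu_{\mathcal{X}}^T\tilde{\mathbf{x}}:\tilde{\mathbf{x}}\text{ is a BFS of }(\hat{\mathbf{A}}_{\mathcal{X}},\mathbf{b})\text{ corresponding to some basis }\mathcal{J}\subset\mathcal{X}\text{ containing }a\}$$ (maximum over the empty set is $-\infty$); if $\max_{a\in\mathcal{X}}\hat\rho_a^k=-\infty$, stop and return $\varnothing$ (a symbol for infeasibility); otherwise remove from $\mathcal{X}$ an arm with the lowest score (ties broken arbitrarily). After round $K-1$ return $\mathcal{X}$. **Gaps.** (Infimum over the empty set is $+\infty$, and $\exp(-\infty)=0$.) For $\mathcal{J}\subset[K+L]$ with $|\mathcal{J}|=L+1$, $$\Delta_{\mathcal{J}}^2=\inf_{\tilde{\mathbf{r}}\in\mathbb{R}^{K_0},\tilde{\mathbf{c}}\in\mathbb{R}^{L\times K_0}}\Big\{\sigma_r^{-2}\sum_{a=1}^{K_0}(r_a-\tilde r_a)^2+\sigma_c^{-2}\sum_{l=1}^L\sum_{a=1}^{K_0}(c_{l,a}-\tilde c_{l,a})^2:\ \tilde{\mathbf{A}}_{\mathcal{I}^*}^{-1}\mathbf{b}\ge0,\ \tilde{\mathbf{A}}_{\mathcal{J}}^{-1}\mathbf{b}\ge0,\ \tilde\mu_{\mathcal{J}}^T\tilde{\mathbf{A}}_{\mathcal{J}}^{-1}\mathbf{b}\ge\tilde\mu_{\mathcal{I}^*}^T\tilde{\mathbf{A}}_{\mathcal{I}^*}^{-1}\mathbf{b}\Big\},$$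 where the constraints include invertibility of the matrices being inverted. For $a\in[K+L]$, $\Delta_a^2=\min\{\Delta_{\mathcal{J}}^2:a\in\mathcal{J}\subset[K+L],|\mathcal{J}|=L+1\}$ (with $\Delta_a\ge 0$), and $\Delta_{(1)}\le\dots\le\Delta_{(K+L)}$ are the values $\Delta_a$, $a\in[K+L]$, in non-decreasing order. Finally, $$\Delta_0^2=\sigma_c^{-2}\inf_{\tilde{\mathbf{c}}\in\mathbb{R}^{L\times K_0}}\Big\{\sum_{l=1}^L\sum_{a=1}^{K_0}(c_{l,a}-\tilde c_{l,a})^2:\ \det(\tilde{\mathbf{A}}_{\mathcal{I}^*})=0\ \text{or}\ \tilde{\mathbf{A}}_{\mathcal{I}^*}^{-1}\mathbf{b}\not\ge0\Big\}.$$ *)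

(* Defs.v *)
From HB Require Import structures.
From mathcomp Require Import all_boot all_order all_algebra.
From mathcomp Require Import all_classical all_reals all_analysis.
Set Implicit Arguments.
Unset Strict Implicit.
Unset Printing Implicit Defensive.
Import Order.TTheory GRing.Theory Num.Theory.
Import numFieldNormedType.Exports.
Local Open Scope classical_set_scope.
Local Open Scope ring_scope.

(* Arms a : 'I_K are 0-based: the unknown arms are those with a < K0.  The
   columns of the linear program are indexed by 'I_(K + L): [lshift L a] is arm
   a, [rshift K l] is the virtual arm (slack variable) of cost type l. *)

Record cbmai (R : realType) (L K : nat) := Cbmai {
  reward : 'cV[R]_K;
  cost : 'M[R]_(L, K);
  cbound : 'cV[R]_L;
  sigma_r : R;
  sigma_c : R
}.

Definition lp_mu (R : realType) (L K : nat) (I : cbmai R L K) : 'cV[R]_(K + L) :=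
  col_mx (reward I) 0.

Definition lp_A (R : realType) (L K : nat) (I : cbmai R L K)
    : 'M[R]_(L + 1, K + L) :=
  block_mx (cost I) 1%:M (const_mx 1) 0.

Definition lp_b (R : realType) (L K : nat) (I : cbmai R L K) : 'cV[R]_(L + 1) :=
  col_mx (cbound I) (const_mx 1).

Definition nonneg_cV (R : realType) (n : nat) (x : 'cV[R]_n) : Prop :=
  forall i, 0 <= x i 0.

Definition lp_feasible (R : realType) (L K : nat) (I : cbmai R L K)
    (x : 'cV[R]_(K + L)) : Prop :=
  lp_A I *m x = lp_b I /\ nonneg_cV x.

Definition lp_optimal (R : realType) (L K : nat) (I : cbmai R L K)
    (x : 'cV[R]_(K + L)) : Prop :=
  lp_feasible I x /\
  forall y, lp_feasible I y ->
    ((lp_mu I)^T *m y) 0 0 <= ((lp_mu I)^T *m x) 0 0.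

Definition lp_unique_optimal (R : realType) (L K : nat) (I : cbmai R L K)
    (x : 'cV[R]_(K + L)) : Prop :=
  lp_optimal I x /\ forall y, lp_optimal I y -> y = x.

Definition supp (R : realType) (n : nat) (x : 'cV[R]_n) : {set 'I_n} :=
  [set i | x i 0 != 0]%SET.

Definition col_basis (L K : nat) : Type := {J : {set 'I_(K + L)} | #|J| == (L + 1)%N}.

Definition basis_idx (L K : nat) (J : col_basis L K) : 'I_(L + 1) -> 'I_(K + L) :=
  fun j => enum_val (cast_ord (esym (eqP (valP J))) j).

(* A_J and v_J, with the elements of J listed in increasing order *)
Definition mx_at (R : realType) (L K : nat) (A : 'M[R]_(L + 1, K + L))
    (J : col_basis L K) : 'M[R]_(L + 1) :=
  colsub (basis_idx J) A.

Definition vec_at (R : realType) (L K : nat) (v : 'cV[R]_(K + L))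
    (J : col_basis L K) : 'cV[R]_(L + 1) :=
  rowsub (basis_idx J) v.

(* A_J^-1 b; only meaningful when mx_at A J is a unit *)
Definition basic_sol (R : realType) (L K : nat) (I : cbmai R L K)
    (J : col_basis L K) : 'cV[R]_(L + 1) :=
  invmx (mx_at (lp_A I) J) *m lp_b I.

Definition basic_feasible (R : realType) (L K : nat) (I : cbmai R L K)
    (J : col_basis L K) : Prop :=
  mx_at (lp_A I) J \in unitmx /\ nonneg_cV (basic_sol I J).

Definition basic_value (R : realType) (L K : nat) (I : cbmai R L K)
    (J : col_basis L K) : R :=
  ((vec_at (lp_mu I) J)^T *m basic_sol I J) 0 0.

Definition is_bfs (R : realType) (L K : nat) (I : cbmai R L K)
    (J : col_basis L K) (x : 'cV[R]_(K + L)) : Prop :=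
  [/\ nonneg_cV x,
      forall i, i \notin val J -> x i 0 = 0,
      basic_feasible I J &
      vec_at x J = basic_sol I J].

(* the instance with the means of the K0 first arms replaced by rt and ct *)
Definition modify (R : realType) (L K K0 : nat) (I : cbmai R L K)
    (rt : 'cV[R]_K0) (ct : 'M[R]_(L, K0)) : cbmai R L K :=
  Cbmai
    (\col_a (if (insub (val a) : option 'I_K0) is Some a0
             then rt a0 0 else reward I a 0))
    (\matrix_(l, a) (if (insub (val a) : option 'I_K0) is Some a0
                     then ct l a0 else cost I l a))
    (cbound I) (sigma_r I) (sigma_c I).

Definition gapJ_sq (R : realType) (L K K0 : nat) (hK : (K0 <= K)%N)
    (I : cbmai R L K) (Istar J : col_basis L K) : \bar R :=
  ereal_inf [set y | exists (rt : 'cV[R]_K0) (ct : 'M[R]_(L, K0)),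
    [/\ basic_feasible (modify I rt ct) Istar,
        basic_feasible (modify I rt ct) J,
        basic_value (modify I rt ct) J >= basic_value (modify I rt ct) Istar &
        y = (sigma_r I ^- 2 *
               (\sum_(a < K0) (reward I (widen_ord hK a) 0 - rt a 0) ^+ 2) +
             sigma_c I ^- 2 *
               (\sum_(l < L) \sum_(a < K0)
                  (cost I l (widen_ord hK a) - ct l a) ^+ 2))%:E]].

Definition arm_gap (R : realType) (L K K0 : nat) (hK : (K0 <= K)%N)
    (I : cbmai R L K) (Istar : col_basis L K) (a : 'I_(K + L)) : \bar R :=
  sqrte (\big[mine/+oo%E]_(J : col_basis L K | a \in val J) gapJ_sq hK I Istar J).

(* the i-th smallest arm gap, i ranging over 1, ..., K + L *)
Definition ordered_gap (R : realType) (L K K0 : nat) (hK : (K0 <= K)%N)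
    (I : cbmai R L K) (Istar : col_basis L K) (i : nat) : \bar R :=
  nth 0%E (sort <=%O [seq arm_gap hK I Istar a | a <- enum 'I_(K + L)]) i.-1.

Definition gap0_sq (R : realType) (L K K0 : nat) (hK : (K0 <= K)%N)
    (I : cbmai R L K) (Istar : col_basis L K) : \bar R :=
  mule (sigma_c I ^- 2)%:E
   (ereal_inf [set y | exists ct : 'M[R]_(L, K0),
     let I' := modify I (\col_a reward I (widen_ord hK a) 0) ct in
     (\det (mx_at (lp_A I') Istar) = 0 \/ ~ nonneg_cV (basic_sol I' Istar)) /\
     y = (\sum_(l < L) \sum_(a < K0)
            (cost I l (widen_ord hK a) - ct l a) ^+ 2)%:E]).

Definition Psi (R : realType) (K0 L : nat) : R :=
  \sum_(1 <= j < K0.+1) (maxn 2 (j - L))%:R^-1.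

Definition cum_pulls (R : realType) (L K K0 N k : nat) : nat :=
  if k == 0%N then 0%N else
  `|Num.ceil ((Psi R K0 L)^-1 * ((N%:R - K0%:R) / (K.+1 - k)%:R))|%N.

Definition phase_pulls (R : realType) (L K K0 N k : nat) : nat :=
  (cum_pulls R L K K0 N k - cum_pulls R L K K0 N k.-1)%N.

Definition emp_mean (R : realType) (u : nat -> R) (n : nat) : R :=
  n%:R^-1 * \sum_(t < n) u t.

(* rs a t and cs l a t are the reward and the cost of type l of the (t+1)-st
   pull of arm a; cnt a is the number of pulls of the unknown arm a so far. *)
Definition empirical (R : realType) (L K K0 : nat) (hK : (K0 <= K)%N)
    (I : cbmai R L K) (rs : 'I_K -> nat -> R) (cs : 'I_L -> 'I_K -> nat -> R)
    (cnt : 'I_K0 -> nat) : cbmai R L K :=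
  modify I (\col_a emp_mean (rs (widen_ord hK a)) (cnt a))
           (\matrix_(l, a) emp_mean (cs l (widen_ord hK a)) (cnt a)).

(* A basic feasible solution of (A_X, b) is represented by its extension by 0
   to all of 'I_(K + L).  The supremum is over a finite set, so it is a maximum,
   or -oo when the set is empty. *)
Definition iv_score (R : realType) (L K : nat) (Ihat : cbmai R L K)
    (X : {set 'I_(K + L)}) (a : 'I_(K + L)) : \bar R :=
  ereal_sup [set y | exists (J : col_basis L K) (x : 'cV[R]_(K + L)),
    [/\ val J \subset X, a \in val J, is_bfs Ihat J x &
        y = (\sum_(i in X) lp_mu Ihat i 0 * x i 0)%:E]].

Definition pull_phase (R : realType) (L K K0 : nat) (hK : (K0 <= K)%N) (N k : nat)
    (X : {set 'I_(K + L)}) (cnt : 'I_K0 -> nat) : 'I_K0 -> nat :=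
  fun a => (cnt a + (if lshift L (widen_ord hK a) \in X
                     then phase_pulls R L K K0 N k else 0))%N.

(* [sfsr_from hK I N rs cs k X cnt o]: on the samples rs and cs, the algorithm
   started at round k with active set X and pull counts cnt can return o, for
   some way of breaking ties; None is the infeasibility symbol. *)
Inductive sfsr_from (R : realType) (L K K0 : nat) (hK : (K0 <= K)%N)
    (I : cbmai R L K) (N : nat)
    (rs : 'I_K -> nat -> R) (cs : 'I_L -> 'I_K -> nat -> R)
  : nat -> {set 'I_(K + L)} -> ('I_K0 -> nat) ->
    option {set 'I_(K + L)} -> Prop :=
| Sfsr_end (k : nat) (X : {set 'I_(K + L)}) (cnt : 'I_K0 -> nat) :
    (K <= k)%N ->
    sfsr_from hK I N rs cs k X cnt (Some X)
| Sfsr_infeasible (k : nat) (X : {set 'I_(K + L)}) (cnt : 'I_K0 -> nat) :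
    (k < K)%N ->
    let cnt' := pull_phase R hK N k X cnt in
    let score := iv_score (empirical hK I rs cs cnt') X in
    \big[maxe/-oo%E]_(a in X) score a = -oo%E ->
    sfsr_from hK I N rs cs k X cnt None
| Sfsr_reject (k : nat) (X : {set 'I_(K + L)}) (cnt : 'I_K0 -> nat)
    (a : 'I_(K + L)) (o : option {set 'I_(K + L)}) :
    (k < K)%N ->
    let cnt' := pull_phase R hK N k X cnt in
    let score := iv_score (empirical hK I rs cs cnt') X in
    \big[maxe/-oo%E]_(a' in X) score a' <> -oo%E ->
    a \in X ->
    (forall a', a' \in X -> (score a <= score a')%E) ->
    sfsr_from hK I N rs cs k.+1 (X :\ a)%SET cnt' o ->
    sfsr_from hK I N rs cs k X cnt o.

Definition sfsr_output (R : realType) (L K K0 : nat) (hK : (K0 <= K)%N)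
    (I : cbmai R L K) (N : nat)
    (rs : 'I_K -> nat -> R) (cs : 'I_L -> 'I_K -> nat -> R)
    (o : option {set 'I_(K + L)}) : Prop :=
  sfsr_from hK I N rs cs 1 [set: 'I_(K + L)]%SET (fun=> 0%N) o.

Definition mutually_independent (R : realType) (d : measure_display)
    (T : measurableType d) (P : probability T R) (J : choiceType)
    (Z : J -> {RV P >-> R}) : Prop :=
  forall (s : seq J) (B : J -> set R), uniq s ->
    (forall j, measurable (B j)) ->
    P (\bigcap_(j in [set` s]) (Z j @^-1` B j)) =
    (\prod_(j <- s) P (Z j @^-1` B j))%E.

Definition has_normal_law (R : realType) (d : measure_display)
    (T : measurableType d) (P : probability T R) (Z : {RV P >-> R})
    (m s : R) : Prop :=
  forall B : set R, measurable B -> distribution P Z B = normal_prob m s B.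

Definition all_samples (R : realType) (d : measure_display)
    (T : measurableType d) (P : probability T R) (L K : nat)
    (rw : 'I_K -> nat -> {RV P >-> R})
    (co : 'I_L -> 'I_K -> nat -> {RV P >-> R})
    (j : ('I_K * nat) + ('I_L * 'I_K * nat)) : {RV P >-> R} :=
  match j with
  | inl (a, t) => rw a t
  | inr (l, a, t) => co l a t
  end.

Definition sample_model (R : realType) (d : measure_display)
    (T : measurableType d) (P : probability T R) (L K : nat) (I : cbmai R L K)
    (rw : 'I_K -> nat -> {RV P >-> R})
    (co : 'I_L -> 'I_K -> nat -> {RV P >-> R}) : Prop :=
  [/\ forall a t, has_normal_law (rw a t) (reward I a 0) (sigma_r I),
      forall l a t, has_normal_law (co l a t) (cost I l a) (sigma_c I) &
      mutually_independent (all_samples rw co)].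

Definition Ntilde (R : realType) (L K0 N : nat) : R :=
  (N%:R - K0%:R) / (3 * ((L%:R + 1) / 2 + ln K0%:R)).

(* Main.v *)
(** A failing run has a first round [k] in which either the empirical instance
    makes the optimal basis infeasible or an arm of the optimal basis has the
    lowest score.  In the second case every surviving arm, in particular the
    surviving arm [j] of largest gap, scores at least the empirical value of
    the optimal basis, so a surviving basis containing [j] is empirically
    feasible and at least as good as the optimal one.  Either way the empirical
    means, kept only on the surviving columns involved and replaced by the true
    means elsewhere, form a competitor in the infimum defining a gap, so the
    normalised squared deviation of at most [2 (L+1)^2] empirical means, all
    based on exactly [n_k] pulls, is at least that gap.  A chi-square Chernoff
    bound with parameter [1/3] and a union bound over rounds and bases
    conclude. *)

Require Import Defs.
From HB Require Import structures.
From mathcomp Require Import all_boot all_order all_algebra.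
From mathcomp Require Import all_classical all_reals all_analysis.
From mathcomp Require Import measurable_realfun ring lra zify.
Set Implicit Arguments.
Unset Strict Implicit.
Unset Printing Implicit Defensive.
Import Order.TTheory GRing.Theory Num.Theory.
Import numFieldNormedType.Exports.
Local Open Scope classical_set_scope.
Local Open Scope ring_scope.

(** * Product formula for independent variables *)

Import HBNNSimple.

(** The identity for indicators passes to simple functions by linearity and to nonnegative [g] by
    monotone convergence. With [H] a product of other factors this lifts independence from events to
    functions; with [X] the identity and [H] a density it gives integration against that density. *)
Lemma integral_comp_density (R : realType) (d d' : measure_display)
    (T : measurableType d) (S : measurableType d')
    (mu : {measure set T -> \bar R}) (nu : {measure set S -> \bar R})
    (X : T -> S) (H : T -> R) (g : S -> R) (c : R) :
  measurable_fun setT X -> measurable_fun setT H -> (forall w, 0 <= H w) ->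
  measurable_fun setT g -> (forall x, 0 <= g x) -> 0 <= c ->
  (forall B, measurable B ->
     \int[mu]_w (\1_B (X w) * H w)%:E = c%:E * nu B)%E ->
  (\int[mu]_w (g (X w) * H w)%:E = c%:E * \int[nu]_x (g x)%:E)%E.
Proof.
move=> mX mH H0 mg g0 c0 HB.
pose h := nnsfun_approx measurableT ((measurable_EFinP setT g).2 mg).
have hg x : (EFin \o h n) x @[n --> \oo] --> (g x)%:E.
  by apply: cvg_nnsfun_approx => //= y _; rewrite lee_fin.
have mhX n : measurable_fun setT (fun w => h n (X w)) by exact: measurableT_comp.
have hnd x : nondecreasing_seq (fun n => (h n x)%:E).
  by move=> a b ab; rewrite lee_fin; exact/lefP/nd_nnsfun_approx.
have simple n :
  (\int[mu]_w (h n (X w) * H w)%:E = c%:E * \int[nu]_x (h n x)%:E)%E.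
  have mind r : measurable_fun setT (fun x => (r * \1_(h n @^-1` [set r]) x)%R).
    exact: measurable_funM.
  transitivity (\int[mu]_w (\sum_(y \in range (h n))
      (y * \1_(h n @^-1` [set y]) (X w) * H w)%:E))%E.
    apply: eq_integral => w _; rewrite fimfunE EFinM.
    rewrite -fsumEFin// ge0_mule_fsuml; last first.
      by move=> r; rewrite EFinM nnfun_muleindic_ge0.
    by apply: eq_fsbigr => r _; rewrite EFinM.
  rewrite ge0_integral_fsum//; last 2 first.
  - move=> r; apply/measurable_EFinP; apply: measurable_funM => //.
    exact: (measurableT_comp (mind r) mX).
  - move=> r w _; rewrite EFinM mule_ge0 ?lee_fin//.
    by rewrite -lee_fin EFinM nnfun_muleindic_ge0.
  transitivity (c%:E * \int[nu]_x (\sum_(y \in range (h n))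
      (y * \1_(h n @^-1` [set y]) x)%:E))%E; last first.
    by congr (_ * _)%E; apply: eq_integral => x _; rewrite fimfunE -fsumEFin.
  rewrite ge0_integral_fsum//; last 2 first.
  - by move=> r; apply/measurable_EFinP.
  - by move=> r x _; rewrite EFinM nnfun_muleindic_ge0.
  rewrite ge0_mule_fsumr; last first.
    by move=> r; apply: integral_ge0 => x _; rewrite EFinM nnfun_muleindic_ge0.
  apply: eq_fsbigr => r; rewrite inE => -[x _ hx].
  have r0 : (0 <= r%:E)%E by rewrite -hx lee_fin.
  have mhr : measurable (h n @^-1` [set r]) by [].
  have mhrX : measurable_fun setT (fun w => \1_(h n @^-1` [set r]) (X w) : R).
    by apply: (measurableT_comp _ mX).
  under eq_integral do rewrite -mulrA EFinM.
  rewrite ge0_integralZl//; last 2 first.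
  - exact/measurable_EFinP/measurable_funM.
  - by move=> w _; rewrite lee_fin mulr_ge0.
  rewrite HB//; under [in RHS]eq_integral do rewrite EFinM.
  rewrite ge0_integralZl//; last exact/measurable_EFinP.
  by rewrite integral_indic ?setIT// muleCA.
have l1 : (\int[mu]_w (h n (X w) * H w)%:E @[n --> \oo] -->
           \int[mu]_w (g (X w) * H w)%:E)%E.
  rewrite (_ : (\int[mu]_w (g (X w) * H w)%:E)%E =
      (\int[mu]_w limn (fun n => (h n (X w) * H w)%:E))%E); last first.
    apply: eq_integral => w _; apply/esym/cvg_lim => //.
    by under eq_fun do rewrite EFinM; rewrite EFinM; apply: cvgeZr => //; exact: hg.
  apply: cvg_monotone_convergence => //.
  - by move=> n; apply/measurable_EFinP/measurable_funM.
  - by move=> n w _; rewrite lee_fin mulr_ge0.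
  - move=> w _ a b ab; rewrite lee_fin ler_wpM2r// -lee_fin.
    exact: hnd.
have l2 : (\int[nu]_x (h n x)%:E @[n --> \oo] --> \int[nu]_x (g x)%:E)%E.
  rewrite (_ : (\int[nu]_x (g x)%:E)%E =
      (\int[nu]_x limn (fun n => (h n x)%:E))%E); last first.
    by apply: eq_integral => x _; apply/esym/cvg_lim => //; exact: hg.
  apply: cvg_monotone_convergence => //.
    by move=> n; apply/measurable_EFinP.
  by move=> n x _; rewrite lee_fin.
rewrite -(cvg_lim _ l1)//; apply/cvg_lim => //.
under eq_fun do rewrite simple.
exact: cvgeZl.
Qed.

(** Independence is given for events only, so the factors are reduced to indicators one after the
    other. Finiteness of the integrals lets the product of the remaining ones serve as the real
    constant [c] of [integral_comp_density]. *)
Lemma integral_prod_indep (R : realType) (d : measure_display)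
    (T : measurableType d) (P : probability T R) (J : choiceType)
    (Z : J -> {RV P >-> R}) (f : J -> R -> R) (s : seq J) :
  mutually_independent Z -> uniq s ->
  (forall j, measurable_fun setT (f j)) -> (forall j x, 0 <= f j x) ->
  (forall j, \int[P]_w (f j (Z j w))%:E \is a fin_num)%E ->
  (\int[P]_w (\prod_(j <- s) f j (Z j w))%:E =
   \prod_(j <- s) \int[P]_w (f j (Z j w))%:E)%E.
Proof.
move=> indZ.
have mZ j : measurable_fun setT (Z j) by exact: measurable_funP.
have mZB j B : measurable B -> measurable (Z j @^-1` B).
  by move=> mB; rewrite -[X in measurable X]setTI; exact: mZ.
(* the functions in [s2] are indicators; those in [s1] are replaced one by one *)
suff: forall s1 s2, uniq (s1 ++ s2) -> forall f : J -> R -> R,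
    (forall j, measurable_fun setT (f j)) -> (forall j x, 0 <= f j x) ->
    (forall j, \int[P]_w (f j (Z j w))%:E \is a fin_num)%E ->
    (forall j, j \in s2 -> exists2 B, measurable B & f j = \1_B) ->
  (\int[P]_w (\prod_(j <- s1 ++ s2) f j (Z j w))%:E =
   \prod_(j <- s1 ++ s2) \int[P]_w (f j (Z j w))%:E)%E.
  move=> H us mf f0 fi.
  by have := H s [::]; rewrite cats0; apply.
elim=> [|j s1 IH] s2 us {}f mf f0 fi fB.
  (* Independence asks for a measurable set at every index; [set0] is a filler outside [s2]. *)
  have /choice[B Bp] : forall j, exists B : set R, measurable B /\
     (j \in s2 -> f j = \1_B).
    move=> j; have [js|js] := boolP (j \in s2); last by exists set0.
    by have [B mB ->] := fB _ js; exists B.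
  rewrite /= (_ : (fun w => _) =
     (fun w => (\1_(\bigcap_(j in [set` s2]) (Z j @^-1` B j)) w)%:E)); last first.
    apply/funext => w; congr EFin.
    rewrite (eq_big_seq (fun j => \1_(B j) (Z j w))); last first.
      by move=> j /(Bp j).2 ->.
    rewrite !indicE; have [wB|wB] := pselect ((\bigcap_(j in [set` s2]) (Z j @^-1` B j)) w).
      rewrite mem_set// big_seq big1// => j js.
      by rewrite indicE mem_set//; apply: wB.
    rewrite memNset//.
    have /existsNP[j /not_implyP[js wj]] : ~ (forall j, [set` s2] j -> (Z j @^-1` B j) w) by [].
    by rewrite (big_rem j)//= indicE memNset ?mul0r.
  rewrite integral_indic ?setIT//; last first.
    apply: fin_bigcap_measurable => [|j _]; first exact: finite_seq.
    by apply: mZB; exact: (Bp j).1.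
  etransitivity; first by apply: indZ => // j; exact: (Bp j).1.
  apply: eq_big_seq => j js; rewrite (Bp j).2//.
  rewrite (_ : (fun w => _) = (fun w => (\1_(Z j @^-1` B j) w)%:E))//.
  by rewrite integral_indic ?setIT//; apply: mZB; exact: (Bp j).1.
move: us => /= /andP[jn us].
rewrite !big_cons; under eq_integral do rewrite big_cons.
have IHf := IH s2 us f mf f0 fi fB.
have /fineK cE : (\prod_(j <- s1 ++ s2) \int[P]_w (f j (Z j w))%:E \is a fin_num)%E.
  by apply/prode_fin_num => // i _; exact: fi.
rewrite -cE muleC.
have mprod : measurable_fun setT (fun w => \prod_(j <- s1 ++ s2) f j (Z j w)).
  by apply: measurable_prod => i _; exact: measurableT_comp.
pose g w := \prod_(j <- s1 ++ s2) f j (Z j w).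
transitivity (\int[P]_w (f j (Z j w) * g w)%:E)%E; first by [].
rewrite (integral_comp_density (nu := distribution P (Z j)) (c :=
  fine (\prod_(j <- s1 ++ s2) \int[P]_w (f j (Z j w))%:E)%E))//; first last.
- move=> B mB; rewrite cE.
(* Replacing [f j] by an indicator moves [j] from the first list to the second, so that the
   induction hypothesis applies. *)
pose f' i := if i == j then (\1_B : R -> R) else f i.
have f'E i : i \in s1 ++ s2 -> f' i = f i.
  by move=> si; rewrite /f'; case: eqP => // ij; rewrite -ij si in jn.
have int1 : (\int[P]_w (\1_B (Z j w))%:E = P (Z j @^-1` B))%E.
  rewrite (_ : (fun w => _) = (fun w => (\1_(Z j @^-1` B) w)%:E))//.
  by rewrite integral_indic ?setIT//; exact: mZB.
have pm : perm_eq (s1 ++ j :: s2) (j :: s1 ++ s2).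
  by rewrite -[s1 ++ s2]/([::] ++ s1 ++ s2) perm_sym (perm_catCA [:: j] s1 s2).
have us' : uniq (s1 ++ j :: s2).
  by rewrite (perm_uniq pm) /= jn.
have := IH (j :: s2) us' f'.
have -> : (\prod_(j0 <- s1 ++ j :: s2) \int[P]_w (f' j0 (Z j0 w))%:E =
   P (Z j @^-1` B) * \prod_(j <- s1 ++ s2) \int[P]_w (f j (Z j w))%:E)%E.
  rewrite (perm_big _ pm) big_cons {1}/f' eqxx int1; congr (_ * _)%E.
  by apply: eq_big_seq => i /f'E ->.
rewrite (muleC (P _)) => <-.
- apply: eq_integral => w _; congr EFin; rewrite (perm_big _ pm) big_cons {1}/f' eqxx.
  by congr (_ * _); apply: eq_big_seq => i /f'E ->.
- by move=> i; rewrite /f'; case: ifP.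
- by move=> i x; rewrite /f'; case: ifP.
- move=> i; rewrite /f'; case: ifP => // /eqP ->.
  by rewrite int1; apply: fin_num_measure; exact: mZB.
- move=> i; rewrite inE => /orP[/eqP->|is2].
    by exists B => //; rewrite /f' eqxx.
  by rewrite f'E ?mem_cat ?is2 ?orbT//; exact: fB.
- rewrite fine_ge0// prode_ge0// => i _; apply: integral_ge0 => w _.
  by rewrite lee_fin.
- by move=> w; apply: prodr_ge0.
by rewrite ge0_integral_distribution//; [exact/measurable_EFinP|move=> x; rewrite lee_fin].
Qed.

(** * Gaussian concentration of empirical means *)

(** Both sides integrate [g] against the law of [Z]: the left one by transport, the right one
    because that law has density [normal_pdf m s]. *)
Lemma normal_law_integral (R : realType) (d : measure_display)
    (T : measurableType d) (P : probability T R) (Z : {RV P >-> R})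
    (m s : R) (g : R -> R) :
  has_normal_law Z m s -> measurable_fun setT g -> (forall x, 0 <= g x) ->
  (\int[P]_w (g (Z w))%:E =
   \int[lebesgue_measure]_x (g x * normal_pdf m s x)%:E)%E.
Proof.
move=> hZ mg g0.
transitivity (1%:E * \int[distribution P Z]_x (g x)%:E)%E.
  by rewrite mul1e ge0_integral_distribution//; exact/measurable_EFinP.
apply/esym; apply: (@integral_comp_density R _ _ (measurableTypeR R) R
  lebesgue_measure (distribution P Z) idfun (normal_pdf m s)) => //.
- by move=> _ B mB; rewrite setTI.
- exact: measurable_normal_pdf.
- exact: normal_pdf_ge0.
move=> B mB; rewrite mul1e; transitivity (normal_prob m s B); last exact/esym/hZ.
rewrite /normal_prob [RHS]integral_mkcond.
apply: eq_integral => x _; rewrite patchE indicE /=.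
by case: ifP => _; rewrite ?mul1r ?mul0r.
Qed.

(** Completing the square: the exponential tilt turns the density of mean [m] into
    [expR (a ^+ 2 / 2)] times the density of mean [m + a * s]. *)
Lemma normal_law_mgf (R : realType) (d : measure_display)
    (T : measurableType d) (P : probability T R) (Z : {RV P >-> R})
    (m s a : R) : 0 < s -> has_normal_law Z m s ->
  (\int[P]_w (expR (a * ((Z w - m) / s)))%:E = (expR (a ^+ 2 / 2))%:E)%E.
Proof.
move=> s0 hZ.
rewrite (normal_law_integral (g := fun x => expR (a * ((x - m) / s))) hZ)//; last first.
  apply: measurableT_comp => //; apply: measurable_funM => //.
  by apply: measurable_funM => //; exact: measurable_funB.
have sn0 : s != 0 by rewrite gt_eqF.
rewrite (_ : (fun x : R => _) =
    (fun x : R => (expR (a ^+ 2 / 2))%:E * (normal_pdf (m + a * s) s x)%:E)%E).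
  rewrite ge0_integralZl ?integral_normal_pdf ?mule1//.
  - by apply/measurable_EFinP; exact: measurable_normal_pdf.
  - by move=> x _; rewrite lee_fin normal_pdf_ge0.
apply/funext => x; rewrite -EFinM !normal_pdfE//; congr EFin.
rewrite mulrCA [RHS]mulrCA /normal_fun; congr (_ * _); rewrite -!expRD.
by congr expR; field.
Qed.

Lemma normal_pdf_mgf (R : realType) (a : R) :
  (\int[lebesgue_measure]_x (expR (a * x) * normal_pdf 0 1 x)%:E =
   (expR (a ^+ 2 / 2))%:E)%E.
Proof.
rewrite (_ : (fun x : R => _) =
    (fun x : R => (expR (a ^+ 2 / 2))%:E * (normal_pdf a 1 x)%:E)%E).
  rewrite ge0_integralZl ?integral_normal_pdf ?mule1//.
  - by apply/measurable_EFinP; exact: measurable_normal_pdf.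
  - by move=> x _; rewrite lee_fin normal_pdf_ge0.
apply/funext => x; rewrite -EFinM !normal_pdfE ?oner_eq0//; congr EFin.
rewrite mulrCA [RHS]mulrCA /normal_fun; congr (_ * _); rewrite -!expRD.
by congr expR; field.
Qed.

(** Since [x ^+ 2 / 3 - x ^+ 2 / 2 = - x ^+ 2 / 6], the integrand is an unnormalised normal density
    of variance 3, and [Num.sqrt 3] is the ratio of the two peaks. *)
Lemma normal_pdf_mgf_sqr (R : realType) :
  (\int[lebesgue_measure]_x (expR (x ^+ 2 / 3) * normal_pdf 0 1 x)%:E =
   (Num.sqrt 3 : R)%:E)%E.
Proof.
have s0 : Num.sqrt 3 != 0 :> R by rewrite gt_eqF// sqrtr_gt0.
rewrite (_ : (fun x : R => _) =
    (fun x : R => (Num.sqrt 3 : R)%:E * (normal_pdf 0 (Num.sqrt 3) x)%:E)%E).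
  rewrite ge0_integralZl ?integral_normal_pdf ?mule1//.
  - by apply/measurable_EFinP; exact: measurable_normal_pdf.
  - by move=> x _; rewrite lee_fin normal_pdf_ge0.
apply/funext => x; rewrite -EFinM !normal_pdfE ?oner_eq0//; congr EFin.
rewrite [LHS]mulrCA [RHS]mulrA /normal_fun -!expRD; congr (_ * _).
  rewrite /normal_peak sqr_sqrtr// expr1n mul1r -mulrnAr.
  by rewrite [in RHS]sqrtrM// invfM mulrA divff// mul1r.
by congr expR; rewrite sqr_sqrtr//; field.
Qed.

(** The empirical mean, centred and scaled to unit variance, written as a sum over pulls so that its
    exponential factors. *)
Definition std_sum (R : realType) (T : Type) (Z : nat -> T -> R) (m s : R)
    (n : nat) (w : T) : R :=
  \sum_(t < n) (Num.sqrt n%:R)^-1 * ((Z t w - m) / s).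

Lemma std_sum_sqr (R : realType) (T : Type) (Z : nat -> T -> R) (m s : R)
    (n : nat) (w : T) : (0 < n)%N ->
  std_sum Z m s n w ^+ 2 = n%:R * ((m - emp_mean (fun t => Z t w) n) / s) ^+ 2.
Proof.
move=> n0; have nn0 : n%:R != 0 :> R by rewrite pnatr_eq0 -lt0n.
rewrite /std_sum -big_distrr /= -mulr_suml sumrB sumr_const card_ord.
rewrite exprMn exprVn sqr_sqrtr// /emp_mean -(mulr_natl m).
set S := \sum_(i < n) Z i w.
have -> : n%:R * ((m - n%:R^-1 * S) / s) ^+ 2 = n%:R * (m - n%:R^-1 * S) ^+ 2 / s ^+ 2.
  by rewrite exprMn mulrA exprVn.
by rewrite exprMn exprVn mulrA; congr (_ / _); field.
Qed.

(** The exponent is a sum over pairs of a variable and a pull, so the expectation factors; the [n]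
    pulls of [e] contribute [expR (a e ^+ 2 / (2 * n))] each. The result is the joint moment
    generating function of independent standard normals. *)
Lemma std_sum_mgf (R : realType) (d : measure_display)
    (T : measurableType d) (P : probability T R) (E : choiceType)
    (Z : E -> nat -> {RV P >-> R}) (m s : E -> R) (n : nat)
    (es : seq E) (a : E -> R) :
  mutually_independent (fun p : E * nat => Z p.1 p.2) ->
  (forall e, 0 < s e) -> (forall e t, has_normal_law (Z e t) (m e) (s e)) ->
  (0 < n)%N -> uniq es ->
  (\int[P]_w (expR (\sum_(e <- es) a e * std_sum (Z e) (m e) (s e) n w))%:E =
   (\prod_(e <- es) expR (a e ^+ 2 / 2))%:E)%E.
Proof.
move=> indZ s0 hZ n0 us; pose q : R := (Num.sqrt n%:R)^-1.
pose f (p : E * nat) (x : R) := expR (a p.1 * q * ((x - m p.1) / s p.1)).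
pose ps := [seq (e, t) | e <- es, t <- iota 0 n].
have ups : uniq ps.
  by apply: allpairs_uniq; rewrite ?iota_uniq// => -[? ?] [? ?].
have intf p : (\int[P]_w (f p (Z p.1 p.2 w))%:E =
    (expR ((a p.1 * q) ^+ 2 / 2))%:E)%E.
  exact: normal_law_mgf.
have mf p : measurable_fun setT (f p).
  apply: measurableT_comp => //; apply: measurable_funM => //.
  by apply: measurable_funM => //; exact: measurable_funB.
transitivity (\int[P]_w (\prod_(p <- ps) f p (Z p.1 p.2 w))%:E)%E.
  apply: eq_integral => w _; congr EFin.
  rewrite -expR_sum; congr expR; rewrite big_allpairs; apply: eq_bigr => e _ /=.
  rewrite /std_sum big_distrr /= (_ : iota 0 n = index_iota 0 n).
    rewrite big_mkord; apply: eq_bigr => t _; exact: mulrA.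
  by rewrite /index_iota subn0.
rewrite (integral_prod_indep (Z := fun p : E * nat => Z p.1 p.2) indZ ups)//.
- rewrite big_allpairs -prodEFin; apply: eq_bigr => e _.
  under eq_bigr do rewrite intf /=.
  rewrite prodEFin -expR_sum big_const_seq; congr (expR _)%:E.
  rewrite count_predT size_iota iter_addr_0 exprMn exprVn sqr_sqrtr//.
  by rewrite -mulr_natr; field; rewrite pnatr_eq0 -lt0n.
- by move=> p x; exact: expR_ge0.
- by move=> p; rewrite intf.
Qed.

(** Linear exponents are covered by [std_sum_mgf]. Each square is linearised by averaging over an
    auxiliary normal variable; Tonelli moves that average outside, where it evaluates to
    [Num.sqrt 3]. *)
Lemma std_sum_sqr_mgf (R : realType) (d : measure_display)
    (T : measurableType d) (P : probability T R) (E : choiceType)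
    (Z : E -> nat -> {RV P >-> R}) (m s : E -> R) (n : nat) (es : seq E) :
  mutually_independent (fun p : E * nat => Z p.1 p.2) ->
  (forall e, 0 < s e) -> (forall e t, has_normal_law (Z e t) (m e) (s e)) ->
  (0 < n)%N -> uniq es ->
  (\int[P]_w (expR (\sum_(e <- es) std_sum (Z e) (m e) (s e) n w ^+ 2 / 3))%:E =
   (Num.sqrt 3 ^+ size es)%:E)%E.
Proof.
move=> indZ s0 hZ n0; pose U e w := std_sum (Z e) (m e) (s e) n w.
have mU e : measurable_fun setT (U e).
  apply: measurable_sum => t; apply: measurable_funM => //.
  by apply: measurable_funM => //; exact: measurable_funB.
have mUs (es' : seq E) (a : E -> R) :
    measurable_fun setT (fun w => \sum_(e <- es') a e * U e w).
  by apply: measurable_sum => e; exact: measurable_funM.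
have mUq (es' : seq E) :
    measurable_fun setT (fun w => \sum_(e <- es') U e w ^+ 2 / 3).
  by apply: measurable_sum => e; apply: measurable_funM => //; exact: measurable_funX.
(* Hubbard-Stratonovich: [expR (u ^+ 2 / 3)] is the expectation of
   [expR (c * u * x)], with [c ^+ 2 = 2 / 3], for a standard normal [x] *)
suff H es1 es2 (a : E -> R) : uniq (es1 ++ es2) ->
  (\int[P]_w (expR (\sum_(e <- es1) U e w ^+ 2 / 3 +
                     \sum_(e <- es2) a e * U e w))%:E =
   (Num.sqrt 3 ^+ size es1 * \prod_(e <- es2) expR (a e ^+ 2 / 2))%:E)%E.
  move=> us; have := H es [::] (fun=> 0); rewrite cats0 big_nil mulr1 => <-//.
  by apply: eq_integral => w _; rewrite big_nil addr0.
elim: es1 es2 a => [|e es1 IH] es2 a us.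
  rewrite mul1r -(std_sum_mgf a indZ s0 hZ n0 us).
  by apply: eq_integral => w _; rewrite big_nil add0r.
move: (us) => /= /andP[ees us1].
pose c : R := Num.sqrt (2 / 3).
have c2 : c ^+ 2 = 2 / 3 by rewrite sqr_sqrtr.
(* The auxiliary value [x] enters the linear coefficient of [e], which thus passes from the squared
   terms to the linear ones. *)
pose a' x e' := if e' == e then c * x else a e'.
pose F x w := expR (\sum_(e <- es1) U e w ^+ 2 / 3 +
                    \sum_(e' <- e :: es2) a' x e' * U e' w).
have FE x w : F x w = expR (\sum_(e <- es1) U e w ^+ 2 / 3 +
   \sum_(e <- es2) a e * U e w) * expR (c * U e w * x).
  rewrite -expRD /F big_cons {1}/a' eqxx; congr expR.
  have -> : \sum_(e' <- es2) a' x e' * U e' w = \sum_(e' <- es2) a e' * U e' w.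
    apply: eq_big_seq => e' e's; rewrite /a'; case: eqP => // ee'.
    by move: ees; rewrite mem_cat -ee' e's orbT.
  by ring.
have us' : uniq (es1 ++ e :: es2).
  rewrite (perm_uniq (_ : perm_eq _ (e :: es1 ++ es2))) //.
  by rewrite -[es1 ++ es2]/([::] ++ es1 ++ es2) perm_sym (perm_catCA [:: e] es1 es2).
transitivity (\int[P]_w \int[lebesgue_measure]_x (F x w * normal_pdf 0 1 x)%:E)%E.
  apply: eq_integral => w _; rewrite big_cons -addrA expRD EFinM.
  rewrite (_ : expR (U e w ^+ 2 / 3) = expR ((c * U e w) ^+ 2 / 2)); last first.
    by congr expR; rewrite exprMn c2; field.
  rewrite -normal_pdf_mgf -ge0_integralZr//; first last.
  - by move=> x _; rewrite lee_fin mulr_ge0 ?expR_ge0// normal_pdf_ge0.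
  - apply/measurable_EFinP/measurable_funM; last exact: measurable_normal_pdf.
    by apply: measurableT_comp => //; exact: measurable_funM.
  by apply: eq_integral => x _; rewrite FE -EFinM; congr EFin; ring.
rewrite (fubini_tonelli (fun z : T * measurableTypeR R =>
  (F z.2 z.1 * normal_pdf 0 1 z.2)%:E))/=; last 2 first.
- apply/measurable_EFinP/measurable_funM; last first.
    by apply: (measurableT_comp (measurable_normal_pdf 0 1)).
  apply: (eq_measurable_fun (fun z : T * measurableTypeR R =>
    expR (\sum_(e <- es1) U e z.1 ^+ 2 / 3 + \sum_(e <- es2) a e * U e z.1) *
    expR (c * U e z.1 * z.2))).
    by move=> z _; rewrite FE.
  apply: measurable_funM; apply: measurableT_comp => //.
    apply: measurable_funD.
      exact: (measurableT_comp (mUq _) measurable_fst).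
    exact: (measurableT_comp (mUs _ _) measurable_fst).
  apply: measurable_funM => //; apply: measurable_funM => //.
  exact: (measurableT_comp (mU _) measurable_fst).
- by move=> z; rewrite lee_fin mulr_ge0 ?expR_ge0// normal_pdf_ge0.
(* By induction the inner integral is a constant [K] times [expR ((c * x) ^+ 2 / 2) = expR (x ^+ 2 /
   3)]. *)
pose K := Num.sqrt 3 ^+ size es1 * \prod_(e <- es2) expR (a e ^+ 2 / 2) : R.
transitivity (\int[lebesgue_measure]_x (K%:E * (expR (x ^+ 2 / 3) * normal_pdf 0 1 x)%:E))%E.
  apply: eq_integral => x _; under eq_integral do rewrite EFinM.
  rewrite ge0_integralZr//; last 3 first.
  - apply/measurable_EFinP; apply: measurableT_comp => //.
    by apply: measurable_funD.
  - by move=> w _; rewrite lee_fin expR_ge0.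
  - by rewrite lee_fin normal_pdf_ge0.
  rewrite (IH (e :: es2) (a' x) us') -!EFinM; congr EFin.
  rewrite big_cons {1}/a' eqxx (eq_big_seq (fun e => expR (a e ^+ 2 / 2))).
    rewrite /K (_ : (c * x) ^+ 2 / 2 = x ^+ 2 / 3); first by ring.
    by rewrite exprMn c2; field.
  move=> e' e's; rewrite /a'; case: eqP => // ee'.
  by move: ees; rewrite mem_cat -ee' e's orbT.
rewrite ge0_integralZl//; last 3 first.
- apply/measurable_EFinP/measurable_funM; last exact: measurable_normal_pdf.
  by apply: measurableT_comp => //; apply: measurable_funM => //; exact: measurable_funX.
- by move=> x _; rewrite lee_fin mulr_ge0 ?expR_ge0// normal_pdf_ge0.
- by rewrite lee_fin mulr_ge0 ?exprn_ge0// prodr_ge0// => i _; exact: expR_ge0.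
by rewrite normal_pdf_mgf_sqr -EFinM; congr EFin; rewrite /K exprS; ring.
Qed.

(** Chernoff's bound with parameter [n%:R / 3]: multiplied by it, the sum of squared deviations
    becomes the exponent of [std_sum_sqr_mgf]. The threshold is an extended real because gaps may be
    infinite. *)
Lemma emp_mean_tail (R : realType) (d : measure_display)
    (T : measurableType d) (P : probability T R) (E : choiceType)
    (Z : E -> nat -> {RV P >-> R}) (m s : E -> R) (n : nat) (es : seq E)
    (x : \bar R) :
  mutually_independent (fun p : E * nat => Z p.1 p.2) ->
  (forall e, 0 < s e) -> (forall e t, has_normal_law (Z e t) (m e) (s e)) ->
  (0 < n)%N -> uniq es ->
  let A := [set w | (x <= (\sum_(e <- es)
     ((m e - emp_mean (fun t => Z e t w) n) / s e) ^+ 2)%:E)%E] in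
  measurable A /\
  (P A <= (Num.sqrt 3 ^+ size es)%:E * expeR (- ((n%:R / 3)%:E * x)))%E.
Proof.
move=> indZ s0 hZ n0 us.
set D := fun w => \sum_(e <- es) ((m e - emp_mean (fun t => Z e t w) n) / s e) ^+ 2.
have mD : measurable_fun setT D.
  apply: measurable_sum => e; apply: measurable_funX; apply: measurable_funM => //.
  apply: measurable_funB => //; apply: measurable_funM => //.
  exact: measurable_sum.
move=> A; have mA : measurable A.
  rewrite (_ : A = setT `&` (EFin \o D) @^-1` [set y | (x <= y)%E]); last by rewrite setTI.
  have -> : [set y | (x <= y)%E] = `[x, +oo[%classic.
    by apply/seteqP; split => y /=; rewrite in_itv/= andbT.
  have /measurable_EFinP mED := mD.
  by apply: mED => //; exact: emeasurable_itv.
split => //.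
have n3 : 0 < n%:R / 3 :> R by rewrite divr_gt0// ltr0n.
(* For [+oo] the event is empty, for [-oo] the bound is [+oo]; only a real threshold calls for
   Chernoff's bound. *)
case: x @A mA => [r||] A mA.
- pose X : {RV P >-> R} := HB.pack D (isMeasurableFun.Build _ _ _ _ _ mD).
  have -> : A = [set w | r <= X w]%R.
    by apply/seteqP; split => w; rewrite /A /= lee_fin.
  rewrite -(std_sum_sqr_mgf indZ s0 hZ n0 us).
  apply: (le_trans (chernoff X r n3)).
  rewrite -EFinM /= lee_pmul2r ?lte_fin ?expR_gt0//.
  rewrite /mmt_gen_fun unlock le_eqVlt; apply/orP; left; apply/eqP.
  apply: eq_integral => w _ /=; congr (expR _)%:E.
  rewrite /X /= /D big_distrl /=; apply: eq_bigr => e _.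
  by rewrite std_sum_sqr//; ring.
- rewrite (_ : A = set0) ?measure0 ?mule_ge0 ?expeR_ge0 ?lee_fin ?exprn_ge0//.
  by apply/seteqP; split => w //; rewrite /A /= leye_eq.
- by rewrite gt0_muleNy ?lte_fin//= gt0_muley ?leey//.
Qed.

(** * Gaps and deviations of the empirical instance *)

(* [inl a] indexes the mean reward of arm [a], [inr (l, a)] its mean cost of
   type [l]. *)
Definition coord (L K : nat) : finType := ('I_K + 'I_L * 'I_K)%type.

Definition coord_mean (R : realType) (L K : nat) (I : cbmai R L K)
    (e : coord L K) : R :=
  match e with inl a => reward I a 0 | inr (l, a) => cost I l a end.

Definition coord_sd (R : realType) (L K : nat) (I : cbmai R L K)
    (e : coord L K) : R :=
  match e with inl _ => sigma_r I | inr _ => sigma_c I end.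

Definition coord_sample (L K : nat) (S : Type) (rs : 'I_K -> nat -> S)
    (cs : 'I_L -> 'I_K -> nat -> S) (e : coord L K) : nat -> S :=
  match e with inl a => rs a | inr (l, a) => cs l a end.

(** Virtual arms in [U] contribute nothing, their columns being deterministic. *)
Definition arm_coords (L K : nat) (U : {set 'I_(K + L)}) : {set coord L K} :=
  [set e : coord L K | lshift L (match e with inl a => a | inr (_, a) => a end) \in U]%SET.

(** Rewards are left out: invertibility and nonnegativity of a basic solution depend on the costs
    alone. *)
Definition cost_coords (L K : nat) (U : {set 'I_(K + L)}) : {set coord L K} :=
  [set e : coord L K | match e with inl _ => false | inr (_, a) => lshift L a \in U end]%SET.

(** One count [n] serves all coordinates, since all surviving unknown arms have been pulled equally
    often. Coordinates of known arms may occur in [S]; they only enlarge the sum. *)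
Definition deviation (R : realType) (L K : nat) (I : cbmai R L K)
    (rs : 'I_K -> nat -> R) (cs : 'I_L -> 'I_K -> nat -> R) (n : nat)
    (S : {set coord L K}) : R :=
  \sum_(e in S)
    ((coord_mean I e - emp_mean (coord_sample rs cs e) n) / coord_sd I e) ^+ 2.

Lemma sum_widen_ord_le (R : realType) (K0 K : nat) (hK : (K0 <= K)%N)
    (p : pred 'I_K) (F : 'I_K -> R) : (forall a, 0 <= F a) ->
  \sum_(a < K0) (if p (widen_ord hK a) then F (widen_ord hK a) else 0) <=
  \sum_(a | p a) F a.
Proof.
move=> F0; rewrite -(big_ord_narrow hK (F := fun a => if p a then F a else 0)).
rewrite [leRHS]big_mkcond [leLHS]big_mkcond; apply: ler_sum => a _.
by case: ifP => // _; case: ifP.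
Qed.

(** Only the columns in [J] enter [A_J] and [mu_J]. Hence means outside [J] can be reset to their
    true values, at no cost in the gap objective. *)
Lemma modify_agree (R : realType) (L K K0 : nat) (hK : (K0 <= K)%N)
    (I : cbmai R L K) (rt rt' : 'cV[R]_K0) (ct ct' : 'M[R]_(L, K0))
    (J : col_basis L K) :
  (forall a, lshift L (widen_ord hK a) \in val J ->
     rt a 0 = rt' a 0 /\ forall l, ct l a = ct' l a) ->
  (basic_feasible (modify I rt ct) J <-> basic_feasible (modify I rt' ct') J) /\
  basic_value (modify I rt ct) J = basic_value (modify I rt' ct') J.
Proof.
move=> agree.
have agreeE a a0 : lshift L a \in val J -> insub (val a) = Some a0 ->
    rt a0 0 = rt' a0 0 /\ forall l, ct l a0 = ct' l a0.
  case: insubP => // a1 _ va aJ [<-]; apply: agree.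
  by rewrite (_ : widen_ord hK a1 = a) //; apply: val_inj; rewrite /= va.
have idxJ i : basis_idx J i \in val J by exact: enum_valP.
have EA : mx_at (lp_A (modify I rt ct)) J = mx_at (lp_A (modify I rt' ct')) J.
  apply/matrixP => i j; rewrite /mx_at [LHS]mxE [RHS]mxE; have := idxJ j.
  case: (split_ordP (basis_idx J j)) => a -> aJ; case: (split_ordP i) => l ->.
  - rewrite !block_mxEul !mxE; case E: insub => [a0|] //.
    by have [_ ->] := agreeE _ _ aJ E.
  - by rewrite !block_mxEdl !mxE.
  - by rewrite !block_mxEur !mxE.
  - by rewrite !block_mxEdr !mxE.
have Em : vec_at (lp_mu (modify I rt ct)) J = vec_at (lp_mu (modify I rt' ct')) J.
  apply/matrixP => i j; rewrite /vec_at [LHS]mxE [RHS]mxE !ord1; have := idxJ i.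
  case: (split_ordP (basis_idx J i)) => a -> aJ.
    by rewrite !col_mxEu !mxE; case E: insub => [a0|] //; have [-> _] := agreeE _ _ aJ E.
  by rewrite !col_mxEd !mxE.
by rewrite /basic_feasible /basic_value /basic_sol EA Em.
Qed.

Lemma deviation_arm_coords (R : realType) (L K : nat) (I : cbmai R L K)
    (rs : 'I_K -> nat -> R) (cs : 'I_L -> 'I_K -> nat -> R) (n : nat)
    (U : {set 'I_(K + L)}) :
  deviation I rs cs n (arm_coords U) =
  \sum_(a | lshift L a \in U) ((reward I a 0 - emp_mean (rs a) n) / sigma_r I) ^+ 2 +
  \sum_l \sum_(a | lshift L a \in U)
    ((cost I l a - emp_mean (cs l a) n) / sigma_c I) ^+ 2.
Proof.
rewrite /deviation big_sumType /=; congr (_ + _).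
  by apply: eq_bigl => a; rewrite inE.
by rewrite pair_big_dep /=; apply: eq_big => -[l a] //=; rewrite inE.
Qed.

Lemma deviation_cost_coords (R : realType) (L K : nat) (I : cbmai R L K)
    (rs : 'I_K -> nat -> R) (cs : 'I_L -> 'I_K -> nat -> R) (n : nat)
    (U : {set 'I_(K + L)}) :
  deviation I rs cs n (cost_coords U) =
  \sum_l \sum_(a | lshift L a \in U)
    ((cost I l a - emp_mean (cs l a) n) / sigma_c I) ^+ 2.
Proof.
rewrite /deviation big_sumType /= big1 ?add0r; last by move=> a; rewrite inE.
by rewrite pair_big_dep /=; apply: eq_big => -[l a] //=; rewrite inE.
Qed.

Lemma gapJ_sq_le_deviation (R : realType) (L K K0 : nat) (hK : (K0 <= K)%N)
    (I : cbmai R L K) (rs : 'I_K -> nat -> R) (cs : 'I_L -> 'I_K -> nat -> R)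
    (cnt : 'I_K0 -> nat) (n : nat) (Istar J : col_basis L K) :
  let Ihat := empirical hK I rs cs cnt in
  (forall a, lshift L (widen_ord hK a) \in val Istar :|: val J -> cnt a = n) ->
  basic_feasible Ihat Istar -> basic_feasible Ihat J ->
  basic_value Ihat Istar <= basic_value Ihat J ->
  (gapJ_sq hK I Istar J <=
   (deviation I rs cs n (arm_coords (val Istar :|: val J)))%:E)%E.
Proof.
move=> Ihat; set U := val Istar :|: val J => hcnt feasI feasJ valIJ.
pose inU (a : 'I_K) := lshift L a \in U.
(* The competitor: empirical means on the columns in [U], true means elsewhere, so that only
   coordinates in [U] are charged. *)
pose rt : 'cV[R]_K0 := \col_a if inU (widen_ord hK a)
  then emp_mean (rs (widen_ord hK a)) n else reward I (widen_ord hK a) 0.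
pose ct : 'M[R]_(L, K0) := \matrix_(l, a) if inU (widen_ord hK a)
  then emp_mean (cs l (widen_ord hK a)) n else cost I l (widen_ord hK a).
have agree (B : col_basis L K) : val B \subset U ->
    (basic_feasible Ihat B <-> basic_feasible (modify I rt ct) B) /\
    basic_value Ihat B = basic_value (modify I rt ct) B.
  move=> /fintype.subsetP BU; apply: (modify_agree (hK := hK)) => a /BU aU.
  by split => [|l]; rewrite !mxE /inU aU hcnt.
have [fI vI] := agree Istar (finset.subsetUl _ _).
have [fJ vJ] := agree J (finset.subsetUr _ _).
apply: (@le_trans _ _ (sigma_r I ^- 2 *
   (\sum_(a < K0) (reward I (widen_ord hK a) 0 - rt a 0) ^+ 2) +
   sigma_c I ^- 2 *
   (\sum_(l < L) \sum_(a < K0) (cost I l (widen_ord hK a) - ct l a) ^+ 2))%:E).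
  apply: ereal_inf_lbound; exists rt, ct; split => //; [exact/fI|exact/fJ|].
  by rewrite -vI -vJ.
rewrite lee_fin deviation_arm_coords lerD//.
  rewrite mulr_sumr.
  apply: le_trans (sum_widen_ord_le hK inU _); last by move=> a; exact: sqr_ge0.
  apply: ler_sum => a _; rewrite mxE; case: ifP => _.
    by rewrite exprMn exprVn mulrC.
  by rewrite subrr expr0n mulr0.
rewrite mulr_sumr; apply: ler_sum => l _; rewrite mulr_sumr.
apply: le_trans (sum_widen_ord_le hK inU _); last by move=> a; exact: sqr_ge0.
apply: ler_sum => a _; rewrite mxE; case: ifP => _.
  by rewrite exprMn exprVn mulrC.
by rewrite subrr expr0n mulr0.
Qed.

Lemma gap0_sq_le_deviation (R : realType) (L K K0 : nat) (hK : (K0 <= K)%N)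
    (I : cbmai R L K) (rs : 'I_K -> nat -> R) (cs : 'I_L -> 'I_K -> nat -> R)
    (cnt : 'I_K0 -> nat) (n : nat) (Istar : col_basis L K) :
  (forall a, lshift L (widen_ord hK a) \in val Istar -> cnt a = n) ->
  ~ basic_feasible (empirical hK I rs cs cnt) Istar ->
  (gap0_sq hK I Istar <=
   (deviation I rs cs n (cost_coords (val Istar)))%:E)%E.
Proof.
move=> hcnt infeas.
pose inU (a : 'I_K) := lshift L a \in val Istar.
pose ct : 'M[R]_(L, K0) := \matrix_(l, a) if inU (widen_ord hK a)
  then emp_mean (cs l (widen_ord hK a)) n else cost I l (widen_ord hK a).
pose I' := modify I (\col_a reward I (widen_ord hK a) 0) ct.
have infeas' : ~ basic_feasible I' Istar.
  apply: contra_not infeas => feas.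
  (* [I''] has the rewards of the empirical instance and the costs [ct]. Feasibility does not see
     rewards, so it carries over from [I'] by conversion, and [modify_agree] then compares [I'']
     with the empirical instance. *)
  pose I'' := modify I (\col_a emp_mean (rs (widen_ord hK a)) (cnt a)) ct.
  have feas'' : basic_feasible I'' Istar by exact: feas.
  have [|fI _] := @modify_agree R L K K0 hK I
    (\col_a emp_mean (rs (widen_ord hK a)) (cnt a))
    (\col_a emp_mean (rs (widen_ord hK a)) (cnt a))
    (\matrix_(l, a) emp_mean (cs l (widen_ord hK a)) (cnt a)) ct Istar.
    by move=> a aU; split => // l; rewrite !mxE /inU aU hcnt.
  exact/fI.
apply: (@le_trans _ _ ((sigma_c I ^- 2)%:E *
    (\sum_(l < L) \sum_(a < K0) (cost I l (widen_ord hK a) - ct l a) ^+ 2)%:E)%E).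
  apply: lee_wpmul2l; first by rewrite lee_fin invr_ge0 sqr_ge0.
  apply: ereal_inf_lbound; exists ct; split => //.
  have [detI|/negP detI] := pselect (mx_at (lp_A I') Istar \in unitmx).
    by right => nonnegI; apply: infeas'.
  by left; apply/eqP; move: detI; rewrite unitmxE unitfE negbK.
rewrite -EFinM lee_fin deviation_cost_coords.
rewrite mulr_sumr; apply: ler_sum => l _; rewrite mulr_sumr.
apply: le_trans (sum_widen_ord_le hK inU _); last by move=> a; exact: sqr_ge0.
apply: ler_sum => a _; rewrite mxE; case: ifP => _.
  by rewrite exprMn exprVn mulrC.
by rewrite subrr expr0n mulr0.
Qed.

(** * Basic feasible solutions, scores and ordered gaps *)

Lemma bfs_value (R : realType) (L K : nat) (I : cbmai R L K)
    (X : {set 'I_(K + L)}) (J : col_basis L K) (x : 'cV[R]_(K + L)) :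
  val J \subset X -> is_bfs I J x ->
  \sum_(i in X) lp_mu I i 0 * x i 0 = basic_value I J.
Proof.
move=> /fintype.subsetP JX [_ x0 _ xJ].
rewrite (bigID (mem (val J))) /= [X in _ + X]big1 ?addr0; last first.
  by move=> i /andP[_ /x0 ->]; rewrite mulr0.
rewrite (eq_bigl (fun i => i \in val J)); last first.
  by move=> i /=; apply/andP/idP => [[]//|iJ]; split => //; exact: JX.
rewrite big_enum_val /= /basic_value -xJ !mxE.
pose eqJ := eqP (valP J).
rewrite (reindex (cast_ord (esym eqJ))); last first.
  by apply: onW_bij; exists (cast_ord eqJ); [exact: cast_ordKV|exact: cast_ordK].
by apply: eq_bigr => j _; rewrite !mxE.
Qed.

Lemma bfs_exists (R : realType) (L K : nat) (I : cbmai R L K) (J : col_basis L K) :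
  basic_feasible I J -> exists x, is_bfs I J x.
Proof.
move=> feas.
have idx_inj : injective (basis_idx J).
  by move=> i j /enum_val_inj /cast_ord_inj.
exists (\col_i \sum_(j | basis_idx J j == i) basic_sol I J j 0); split => //.
- by move=> i; rewrite mxE; apply: sumr_ge0 => j _; case: feas => _; apply.
- move=> i iJ; rewrite mxE big_pred0// => j; apply/negP => /eqP ij.
  by move: iJ; rewrite -ij enum_valP.
- apply/matrixP => i j; rewrite !mxE !ord1 (big_pred1 i) ?mxE// => k.
  by rewrite /= (inj_eq idx_inj).
Qed.

Lemma iv_score_ge (R : realType) (L K : nat) (I : cbmai R L K)
    (X : {set 'I_(K + L)}) (J : col_basis L K) (a : 'I_(K + L)) :
  val J \subset X -> a \in val J -> basic_feasible I J ->
  ((basic_value I J)%:E <= iv_score I X a)%E.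
Proof.
move=> JX aJ /bfs_exists[x bx]; apply: ereal_sup_ubound.
by exists J, x; split => //; rewrite (bfs_value JX bx).
Qed.

(** By [bfs_value] the supremum ranges over finitely many values, one per basis. If all of them were
    below [v], so would be their maximum, which is [-oo] when no basis qualifies. *)
Lemma iv_score_attained (R : realType) (L K : nat) (I : cbmai R L K)
    (X : {set 'I_(K + L)}) (a : 'I_(K + L)) (v : R) :
  (v%:E <= iv_score I X a)%E ->
  exists J : col_basis L K, [/\ val J \subset X, a \in val J, basic_feasible I J &
    v <= basic_value I J].
Proof.
move=> vle; apply: contrapT => nJ.
pose Q (J : col_basis L K) :=
  `[< [/\ val J \subset X, a \in val J & basic_feasible I J] >].
suff : (iv_score I X a < v%:E)%E by rewrite ltNge vle.
apply: (@le_lt_trans _ _ (\big[maxe/-oo%E]_(J | Q J) (basic_value I J)%:E)).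
  apply: ge_ereal_sup => _ [J [x [JX aJ bx ->]]].
  rewrite (bfs_value JX bx).
  apply: (@le_bigmax_cond _ _ _ _ J Q (fun J => (basic_value I J)%:E)).
  by apply/asboolP; case: bx.
apply: bigmax_lt; first exact: ltNyr.
move=> J /asboolP[JX aJ fJ]; rewrite lte_fin ltNge; apply/negP => vJ.
by apply: nJ; exists J.
Qed.

(** Pigeonhole: otherwise [#|X|] entries of the sorted list would lie strictly below the entry at
    position [#|X|.-1], which only [#|X|.-1] entries precede. *)
Lemma exists_ge_sorted_nth (d : Order.disp_t) (O : orderType d) (T : finType)
    (f : T -> O) (X : {set T}) (x0 : O) : (0 < #|X|)%N ->
  exists2 a, a \in X &
    (nth x0 (sort <=%O [seq f a | a <- enum T]) #|X|.-1 <= f a)%O.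
Proof.
move=> X0; apply: contrapT => nX; set s := sort _ _ in nX *.
set v := nth x0 s _ in nX *.
have szs : size s = #|T| by rewrite size_sort size_map -cardE.
have ltv a : a \in X -> (f a < v)%O.
  by move=> aX; rewrite ltNge; apply/negP => va; apply: nX; exists a.
have c1 : (#|X| <= count (fun y => (y < v)%O) s)%N.
  rewrite (seq.permP (introT permPl (perm_sort _ _))) count_map -size_filter.
  rewrite cardE; apply: uniq_leq_size; first exact: enum_uniq.
  by move=> a; rewrite mem_enum mem_filter mem_enum /= andbT => /ltv.
have : (count (fun y => (y < v)%O) s <= #|X|.-1)%N.
  rewrite -{1}(cat_take_drop #|X|.-1 s) count_cat.
  have -> : count (fun y => (y < v)%O) (drop #|X|.-1 s) = 0%N.
    apply/eqP; rewrite -leqn0 leqNgt -has_count; apply/hasPn => y.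
    move=> /(nthP x0)[i]; rewrite size_drop nth_drop => hi <-.
    rewrite -leNgt; apply: le_sorted_leq_nth; rewrite ?inE ?leq_addr//.
    - exact: sort_le_sorted.
    - by rewrite szs (leq_trans _ (max_card (mem X)))// prednK.
    - by rewrite -ltn_subRL.
  by rewrite addn0 (leq_trans (count_size _ _))// size_take_min geq_minl.
by rewrite leqNgt (leq_trans _ c1)// prednK.
Qed.

Lemma gapJ_sq_ge0 (R : realType) (L K K0 : nat) (hK : (K0 <= K)%N)
    (I : cbmai R L K) (Istar J : col_basis L K) : (0 <= gapJ_sq hK I Istar J)%E.
Proof.
apply: le_ereal_inf_tmp => _ [rt [ct [_ _ _ ->]]]; rewrite lee_fin addr_ge0//.
  by rewrite mulr_ge0 ?invr_ge0 ?sqr_ge0// sumr_ge0// => *; exact: sqr_ge0.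
rewrite mulr_ge0 ?invr_ge0 ?sqr_ge0// sumr_ge0// => *.
by rewrite sumr_ge0// => *; exact: sqr_ge0.
Qed.

Lemma arm_gap_sqr_le (R : realType) (L K K0 : nat) (hK : (K0 <= K)%N)
    (I : cbmai R L K) (Istar J : col_basis L K) (a : 'I_(K + L)) :
  a \in val J -> (arm_gap hK I Istar a ^+ 2 <= gapJ_sq hK I Istar J)%E.
Proof.
move=> aJ; rewrite sqr_sqrte; last first.
  by apply: le_bigmin => // *; exact: gapJ_sq_ge0.
exact: (@bigmin_le_cond _ _ _ _ J (fun J : col_basis L K => a \in val J)).
Qed.

Lemma ordered_gap_ge0 (R : realType) (L K K0 : nat) (hK : (K0 <= K)%N)
    (I : cbmai R L K) (Istar : col_basis L K) (i : nat) :
  (0 <= ordered_gap hK I Istar i)%E.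
Proof.
rewrite /ordered_gap; set s := sort _ _.
have [si|si] := leqP (size s) i.-1; first by rewrite nth_default.
have := mem_nth 0%E si; rewrite mem_sort => /mapP[a _ ->].
exact: sqrte_ge0.
Qed.

(** * Runs of the algorithm *)

(** One round on a good sample keeps the optimal basis. Deviations need control only for bases whose
    gap reaches the [#|X|]-th smallest arm gap, because the competing basis can be chosen to contain
    a survivor with such a gap. *)
Lemma sfsr_round (R : realType) (L K K0 : nat) (hK : (K0 <= K)%N)
    (I : cbmai R L K) (rs : 'I_K -> nat -> R) (cs : 'I_L -> 'I_K -> nat -> R)
    (cnt : 'I_K0 -> nat) (n : nat) (Istar : col_basis L K)
    (X : {set 'I_(K + L)}) :
  val Istar \subset X ->
  (forall a, lshift L (widen_ord hK a) \in X -> cnt a = n) ->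
  ((deviation I rs cs n (cost_coords (val Istar)))%:E < gap0_sq hK I Istar)%E ->
  (forall J, ordered_gap hK I Istar #|X| ^+ 2 <= gapJ_sq hK I Istar J ->
     (deviation I rs cs n (arm_coords (val Istar :|: val J)))%:E <
     gapJ_sq hK I Istar J)%E ->
  let score := iv_score (empirical hK I rs cs cnt) X in
  \big[maxe/-oo%E]_(a in X) score a <> -oo%E /\
  forall a, a \in X -> (forall a', a' \in X -> (score a <= score a')%E) ->
    a \notin val Istar.
Proof.
move=> /fintype.subsetP IX hcnt dev0 devJ score.
set Ihat := empirical hK I rs cs cnt in score *.
have feasI : basic_feasible Ihat Istar.
  apply: contrapT => infeas; move: dev0; rewrite ltNge => /negP; apply.
  by apply: gap0_sq_le_deviation infeas => a /IX; exact: hcnt.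
have scoreI a : a \in val Istar -> ((basic_value Ihat Istar)%:E <= score a)%E.
  by move=> aI; apply: iv_score_ge => //; exact/fintype.subsetP.
have cardI : (0 < #|val Istar|)%N by rewrite (eqP (valP Istar)) addn1.
have [i iI] : exists i, i \in val Istar by move/card_gt0P: cardI.
split.
  apply/eqP; rewrite gt_eqF// (@lt_le_trans _ _ (score i))//.
    by rewrite (lt_le_trans _ (scoreI _ iI))// ltNyr.
  exact: (@le_bigmax_cond _ _ _ _ i (fun a => a \in X) score (IX _ iI)).
move=> a aX amin; apply/negP => aI.
have X0 : (0 < #|X|)%N by apply/card_gt0P; exists a.
(* The survivor [j] scores at least as much as the lowest arm [a]; if [a] is in [Istar], this is at
   least the value of [Istar], and a basis [J] through [j] attains it. *)
have [j jX jgap] := exists_ge_sorted_nth (arm_gap hK I Istar) 0%E X0.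
have [J [/fintype.subsetP JX jJ feasJ valJ]] :=
  iv_score_attained (le_trans (scoreI _ aI) (amin _ jX)).
have gapJ : (ordered_gap hK I Istar #|X| ^+ 2 <= gapJ_sq hK I Istar J)%E.
  apply: le_trans (arm_gap_sqr_le hK I Istar jJ).
  by rewrite lee_sqr ?ordered_gap_ge0 ?sqrte_ge0.
have := devJ _ gapJ; rewrite ltNge => /negP; apply.
apply: gapJ_sq_le_deviation feasI feasJ valJ => b.
by rewrite finset.in_setU => /orP[/IX|/JX]; exact: hcnt.
Qed.

(** * Pull counts and the invariant of a run *)

Lemma Psi_gt0 (R : realType) (L K0 : nat) : (1 <= K0)%N -> 0 < Psi R K0 L.
Proof.
move=> K01; rewrite /Psi big_ltn// ltr_wpDr ?invr_gt0 ?ltr0n ?leq_max//.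
by apply: sumr_ge0 => j _; rewrite invr_ge0.
Qed.

Lemma cum_pulls_ge (R : realType) (L K K0 N k : nat) :
  (1 <= K0 < N)%N -> (0 < k <= K)%N ->
  (Psi R K0 L)^-1 * ((N%:R - K0%:R) / (K.+1 - k)%:R) <=
  (cum_pulls R L K K0 N k)%:R.
Proof.
move=> /andP[K01 hN] /andP[k0 kK]; rewrite /cum_pulls gtn_eqF//.
set x := _ * _; have x0 : 0 <= x.
  rewrite mulr_ge0 ?invr_ge0 ?(ltW (Psi_gt0 _ _ K01))// divr_ge0//.
  by rewrite subr_ge0 ler_nat ltnW.
rewrite natr_absz ger0_norm ?ceil_ge0 ?(lt_le_trans _ x0)//.
exact: ceil_ge.
Qed.

Lemma cum_pulls_gt0 (R : realType) (L K K0 N k : nat) :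
  (1 <= K0 < N)%N -> (0 < k <= K)%N -> (0 < cum_pulls R L K K0 N k)%N.
Proof.
move=> KN kK; rewrite -(ltr0n R); apply: lt_le_trans (cum_pulls_ge R L KN kK).
move: KN kK => /andP[K01 hN] /andP[k0 kK].
by rewrite mulr_gt0 ?invr_gt0 ?Psi_gt0// divr_gt0 ?subr_gt0 ?ltr_nat ?ltr0n ?subn_gt0.
Qed.

(** Monotonicity keeps the truncated subtraction in [phase_pulls] exact, so that the phases
    telescope to [cum_pulls]. *)
Lemma leq_cum_pulls (R : realType) (L K K0 N k : nat) :
  (1 <= K0 < N)%N -> (0 < k <= K)%N ->
  (cum_pulls R L K K0 N k.-1 <= cum_pulls R L K K0 N k)%N.
Proof.
move=> /andP[K01 hN] /andP[]; case: k => [//|[//|k]] _ kK.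
rewrite /cum_pulls /=; set x := _ * _; set y := _ * _.
have NK : 0 <= N%:R - K0%:R :> R by rewrite subr_ge0 ler_nat ltnW.
have psi0 := Psi_gt0 R L K01.
have x0 : 0 <= x by rewrite mulr_ge0 ?invr_ge0 ?(ltW psi0)// divr_ge0.
have y0 : 0 <= y by rewrite mulr_ge0 ?invr_ge0 ?(ltW psi0)// divr_ge0.
have xy : x <= y.
  rewrite /x /y ler_pM2l ?invr_gt0// ler_wpM2l// lef_pV2 ?posrE ?ltr0n ?subn_gt0//.
    by rewrite ler_nat; apply: leq_sub2l.
  exact: ltnW.
rewrite -(ler_nat R) !natr_absz !ger0_norm ?ceil_ge0 ?(lt_le_trans _ x0) ?(lt_le_trans _ y0)//.
by rewrite ler_int ceil_le.
Qed.

Lemma sfsr_correct (R : realType) (L K K0 N : nat) (hK : (K0 <= K)%N)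
    (I : cbmai R L K) (rs : 'I_K -> nat -> R) (cs : 'I_L -> 'I_K -> nat -> R)
    (Istar : col_basis L K) (o : option {set 'I_(K + L)}) :
  (1 <= K0 < N)%N ->
  (forall k, (0 < k < K)%N ->
     let n := cum_pulls R L K K0 N k in
     ((deviation I rs cs n (cost_coords (val Istar)))%:E < gap0_sq hK I Istar)%E /\
     (forall J,
        ordered_gap hK I Istar (K.+1 - k + L) ^+ 2 <= gapJ_sq hK I Istar J ->
        (deviation I rs cs n (arm_coords (val Istar :|: val J)))%:E <
        gapJ_sq hK I Istar J)%E) ->
  sfsr_output hK I N rs cs o -> o = Some (val Istar).
Proof.
move=> KN good; rewrite /sfsr_output => run.
(* The invariant at the start of round [k]: [k - 1] arms are gone, [Istar] survives, and each
   surviving unknown arm has the cumulative count of round [k.-1]. *)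
suff H k X cnt : sfsr_from hK I N rs cs k X cnt o -> (0 < k <= K)%N ->
    #|X| = (K.+1 - k + L)%N -> val Istar \subset X ->
    (forall a, lshift L (widen_ord hK a) \in X -> cnt a = cum_pulls R L K K0 N k.-1) ->
    o = Some (val Istar).
  apply: (H _ _ _ run) => //.
  - by case/andP: KN => K01 _; rewrite (leq_trans K01 hK).
  - by rewrite cardsT card_ord subn1.
move=> {run}; elim=> {k X cnt o}.
(* Here [k = K], so [X] has [L + 1] elements and contains [Istar]: they coincide. *)
- move=> k X cnt Kk /andP[k0 kK] cX IX _; congr Some; apply/esym/eqP.
  rewrite eqEcard IX cX (eqP (valP Istar)) (_ : k = K); last exact/anti_leq/andP.
  by rewrite subSnn (addnC L) leqnn.
- move=> k X cnt kK cnt' score maxN /andP[k0 _] cX IX hcnt.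
  have [|dev0 devJ] := good k; first by rewrite k0.
  rewrite -cX in devJ.
  have cnt'E a : lshift L (widen_ord hK a) \in X -> cnt' a = cum_pulls R L K K0 N k.
    move=> aX; rewrite /cnt' /pull_phase aX hcnt// /phase_pulls subnKC//.
    by apply: leq_cum_pulls => //; rewrite k0 ltnW.
  by have [] := sfsr_round IX cnt'E dev0 devJ.
move=> k X cnt a o kK cnt' score _ aX amin _ IH /andP[k0 _] cX IX hcnt.
have [|dev0 devJ] := good k; first by rewrite k0.
rewrite -cX in devJ.
have cnt'E b : lshift L (widen_ord hK b) \in X -> cnt' b = cum_pulls R L K K0 N k.
  move=> bX; rewrite /cnt' /pull_phase bX hcnt// /phase_pulls subnKC//.
  by apply: leq_cum_pulls => //; rewrite k0 ltnW.
have [_ /(_ a aX amin) aI] := sfsr_round IX cnt'E dev0 devJ.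
apply: IH => //.
- by have := cardsD1 a X; rewrite aX cX subSn ?(ltnW kK)// subSS addSn add1n => -[->].
- by rewrite subsetD1 IX.
- by move=> b; rewrite in_setD1 => /andP[_]; exact: cnt'E.
Qed.

(** * Union bound *)

(** The terms with [j <= L + 2] equal 1/2; the later ones, 1/3, 1/4 and so on, are bounded by
    increments of [ln]. This gives [(L + 2) / 2 - ln 2] plus a logarithm, and [ln 2 >= 1/2] absorbs
    the extra half. *)
Lemma Psi_le (R : realType) (L K0 : nat) : (1 <= K0)%N ->
  Psi R K0 L <= (L%:R + 1) / 2 + ln K0%:R.
Proof.
move=> K01.
have ln_ge (x : R) : 0 < x -> 1 - x^-1 <= ln x.
  move=> x0; have : -1 < x^-1 - 1 by rewrite ltrBDr addrC subrr invr_gt0.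
  by move=> /le_ln1Dx; rewrite addrC subrK lnV ?posrE// => h; rewrite -lerN2 opprB.
have ln2 : 2^-1 <= ln 2 :> R by apply: le_trans (ln_ge 2 _) => //; lra.
have half n : Psi R n L <= n%:R / 2.
  rewrite /Psi; elim: n => [|n IH]; first by rewrite big_geq// mul0r.
  rewrite big_nat_recr//= -natr1 mulrDl lerD// mul1r.
  by rewrite lef_pV2 ?posrE ?ltr0n ?leq_max// ler_nat leq_maxl.
have harm m : Psi R (L + 2 + m) L <= (L%:R + 2) / 2 + ln (m%:R + 2) - ln 2.
  elim: m => [|m IH].
    by rewrite addn0 add0r addrK (le_trans (half _))// natrD.
  rewrite /Psi addnS big_nat_recr//= -/(Psi R (L + 2 + m) L).
  rewrite (_ : maxn 2 ((L + 2 + m).+1 - L) = m.+3); last first.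
    by rewrite -addnS -addnA addKn add2n; apply/maxn_idPr.
  have m2 : 0 < m%:R + 2 :> R by rewrite ltr_wpDl.
  have m3 : 0 < m%:R + 3 :> R by rewrite ltr_wpDl.
  have := ln_ge _ (divr_gt0 m3 m2); rewrite ln_div ?posrE//.
  rewrite (_ : 1 - _ = m.+3%:R^-1); last first.
    by rewrite invf_div -addn3 natrD; field; rewrite gt_eqF.
  have -> : m.+1%:R + 2 = m%:R + 3 :> R by rewrite -natr1; ring.
  by move: IH {ln2}; move: (Psi _ _ _) (ln _) (ln _) (m.+3%:R^-1) (ln 2) => *; lra.
have [K0L|K0L] := leqP K0 L.+1.
  apply: le_trans (half K0) _; rewrite -[leLHS]addr0 lerD ?ln_ge0 ?ler1n//.
  by rewrite ler_pM2r ?invr_gt0// natr1 ler_nat.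
rewrite -(subnKC K0L) -addn2; set m := (K0 - _)%N.
apply: le_trans (harm m) _.
have : ln (m%:R + 2) <= ln (L + 2 + m)%:R :> R.
  rewrite ler_ln ?posrE ?ltr_wpDl// ?ltr0n ?addn2//.
  by rewrite -natrD ler_nat; lia.
lra.
Qed.

Lemma card_arm_coords (L K : nat) (U : {set 'I_(K + L)}) :
  (#|arm_coords U| <= L.+1 * #|U|)%N.
Proof.
(* Each arm carries one reward, coded by [None], and [L] costs: hence the factor [L.+1]. *)
pose f (e : coord L K) : 'I_(K + L) * option 'I_L :=
  match e with inl a => (lshift L a, None) | inr (l, a) => (lshift L a, Some l) end.
have f_inj : injective f.
  by move=> [a|[l a]] [b|[l' b]] //= []; [move=> /val_inj ->|move=> /val_inj -> ->].
rewrite -(card_imset _ f_inj).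
apply: (@leq_trans #|finset.setX U [set: option 'I_L]%SET|).
  apply: subset_leq_card; apply/fintype.subsetP => _ /imsetP[e + ->].
  by case: e => [a|[l a]]; rewrite inE /= finset.in_setX inE andbT.
by rewrite cardsX cardsT card_option card_ord mulnC.
Qed.

Lemma card_cost_coords (L K : nat) (U : {set 'I_(K + L)}) :
  (#|cost_coords U| <= L.+1 * #|U|)%N.
Proof.
apply: leq_trans (card_arm_coords U); apply: subset_leq_card.
by apply/fintype.subsetP => -[a|[l a]]; rewrite !inE.
Qed.

(** The binomial coefficient is at most [(K + L) ^ L.+1], and [K + L <= L.+1 * K] separates the
    power of [K] from a factor depending on [L] only. *)
Lemma card_col_basis (L K : nat) : (0 < K)%N ->
  (#|{: col_basis L K}| <= (L.+1 * K) ^ L.+1)%N.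
Proof.
move=> K0.
have -> : #|{: col_basis L K}| = 'C(K + L, L.+1).
  rewrite card_sig -[X in 'C(X, _)](card_ord (K + L)) -card_draws cardsE addn1.
  by apply: eq_card => J; rewrite inE.
have ffact_le n m : (n ^_ m <= n ^ m)%N.
  by elim: m => [//|m IH]; rewrite ffactnSr expnSr leq_mul// leq_subr.
apply: (@leq_trans ((K + L) ^_ L.+1)).
  by rewrite -bin_ffact leq_pmulr// fact_gt0.
apply: leq_trans (ffact_le _ _) _; rewrite leq_exp2r//.
by rewrite mulSn leq_add2l leq_pmulr.
Qed.

Lemma coord_sample_indep (R : realType) (d : measure_display)
    (T : measurableType d) (P : probability T R) (L K : nat)
    (rw : 'I_K -> nat -> {RV P >-> R})
    (co : 'I_L -> 'I_K -> nat -> {RV P >-> R}) :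
  mutually_independent (all_samples rw co) ->
  mutually_independent (fun p : coord L K * nat => coord_sample rw co p.1 p.2).
Proof.
move=> ind s B us mB.
pose g (p : coord L K * nat) : ('I_K * nat) + ('I_L * 'I_K * nat) :=
  match p with (inl a, t) => inl (a, t) | (inr (l, a), t) => inr (l, a, t) end.
pose h (j : ('I_K * nat) + ('I_L * 'I_K * nat)) : coord L K * nat :=
  match j with inl (a, t) => (inl a, t) | inr (l, a, t) => (inr (l, a), t) end.
have gK : cancel g h by move=> [[a|[l a]] t].
have gE p : all_samples rw co (g p) = coord_sample rw co p.1 p.2.
  by case: p => [[a|[l a]] t].
have := ind [seq g p | p <- s] (B \o h); rewrite map_inj_uniq; last exact: can_inj gK.
move=> /(_ us (fun j => mB (h j))); rewrite big_map.
under eq_bigr do rewrite /= gK gE.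
move=> <-; congr (P _); apply/seteqP; split => w /= Hw.
  by move=> j /= /mapP[p ps ->]; rewrite /= gK gE; exact: Hw.
by move=> p ps; have := Hw (g p) (map_f _ ps); rewrite /= gK gE.
Qed.

Lemma deviation_tail (R : realType) (d : measure_display)
    (T : measurableType d) (P : probability T R) (L K : nat) (I : cbmai R L K)
    (rw : 'I_K -> nat -> {RV P >-> R})
    (co : 'I_L -> 'I_K -> nat -> {RV P >-> R}) (n : nat) (S : {set coord L K})
    (x : \bar R) :
  sample_model I rw co -> 0 < sigma_r I -> 0 < sigma_c I -> (0 < n)%N ->
  let A := [set w | (x <= (deviation I (fun a t => rw a t w)
              (fun l a t => co l a t w) n S)%:E)%E] in
  measurable A /\ (P A <= (3 ^+ #|S|)%:E * expeR (- ((n%:R / 3)%:E * x)))%E.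
Proof.
move=> [hrw hco ind] hr hc n0.
have hsd (e : coord L K) : 0 < coord_sd I e by case: e.
have hlaw (e : coord L K) t :
    has_normal_law (coord_sample rw co e t) (coord_mean I e) (coord_sd I e).
  by case: e => [a|[l a]]; [exact: hrw|exact: hco].
have := emp_mean_tail x (coord_sample_indep ind) hsd hlaw n0 (enum_uniq S).
set A' := [set w | _]; move=> [mA' PA'] A.
have dev_enum w :
    deviation I (fun a t => rw a t w) (fun l a t => co l a t w) n S =
    \sum_(e <- enum S)
      ((coord_mean I e - emp_mean (fun t => coord_sample rw co e t w) n) /
       coord_sd I e) ^+ 2.
  by rewrite /deviation big_enum; apply: eq_bigr => -[a|[l a]].
have -> : A = A' by apply/seteqP; split => w; rewrite /A /A' /= dev_enum.
split => //; apply: le_trans PA' _; rewrite -cardE.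
apply: lee_wpmul2r; first exact: expeR_ge0.
rewrite lee_fin lerXn2r ?nnegrE//.
apply: (@le_trans _ _ (Num.sqrt (3 ^+ 2))); first by rewrite ler_sqrt//; lra.
by rewrite sqrtr_sqr ger0_norm.
Qed.

Lemma finite_union_bound (R : realType) (d : measure_display)
    (T : measurableType d) (P : probability T R) (J : eqType) (s : seq J)
    (A : J -> set T) (c : \bar R) :
  (forall j, j \in s -> measurable (A j) /\ (P (A j) <= c)%E) ->
  measurable (\big[setU/set0]_(j <- s) A j) /\
  (P (\big[setU/set0]_(j <- s) A j) <= (size s)%:R%:E * c)%E.
Proof.
elim: s => [|j s IH] hA; first by rewrite big_nil measure0 mul0e.
have [mAj PAj] := hA j (mem_head _ _).
have [|mU PU] := IH; first by move=> i si; apply: hA; rewrite inE si orbT.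
rewrite big_cons; split; first exact: measurableU.
have c0 : (0 <= c)%E by apply: le_trans PAj; exact: measure_ge0.
apply: le_trans (measureU2 _ _ _) _ => //=.
rewrite -add1n natrD EFinD ge0_muleDl ?lee_fin// mul1e.
exact: leeD.
Qed.

(** The 3 in [Ntilde] is the Chernoff parameter 1/3, and its other factor bounds [Psi]. The freedom
    in [i] serves both exponents: [i = K] for infeasibility, [i = K.+1 - k] for a wrong
    rejection. *)
Lemma Ntilde_le_cum_pulls (R : realType) (L K K0 N k i : nat) :
  (1 <= L)%N -> (1 <= K0 < N)%N -> (0 < k <= K)%N -> (K.+1 - k <= i)%N ->
  Ntilde R L K0 N * i%:R^-1 <= (cum_pulls R L K K0 N k)%:R / 3.
Proof.
move=> hL KN kK ki; have := cum_pulls_ge R L KN kK.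
move: KN kK => /andP[K01 hN] /andP[k0 kK].
have psi0 := Psi_gt0 R L K01; have psi_le := Psi_le R L K01.
set q := (_ / _ + _) in psi_le; have q0 : 0 < q by exact: lt_le_trans psi_le.
have NK : 0 < N%:R - K0%:R :> R by rewrite subr_gt0 ltr_nat.
have i'0 : 0 < (K.+1 - k)%:R :> R by rewrite ltr0n subn_gt0 ltnS.
have i0 : 0 < i%:R :> R by rewrite ltr0n (leq_trans _ ki)// subn_gt0.
move=> n_ge; rewrite ler_pdivlMr//; apply: le_trans n_ge.
rewrite /Ntilde -/q (_ : _ * 3 = q^-1 * ((N%:R - K0%:R) / i%:R)); last first.
  by field; rewrite ?gt_eqF.
apply: ler_pM.
- by rewrite invr_ge0 ltW.
- by rewrite divr_ge0 ?ltW.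
- by rewrite lef_pV2 ?posrE.
- by rewrite ler_pM2l// lef_pV2 ?posrE// ler_nat.
Qed.

Lemma Ntilde_ge0 (R : realType) (L K0 N : nat) : (1 <= K0 < N)%N ->
  0 <= Ntilde R L K0 N.
Proof.
move=> /andP[K01 hN]; rewrite /Ntilde divr_ge0 ?subr_ge0 ?ler_nat ?(ltnW hN)//.
by rewrite mulr_ge0// addr_ge0 ?divr_ge0 ?ln_ge0 ?ler1n ?addr_ge0.
Qed.

Theorem theorem1 (R : realType) (L : nat) (hL : (1 <= L)%N) :
  exists C1 C2 : R, [/\ 0 < C1, 0 < C2 &
  forall (K K0 N : nat) (hK2 : (2 <= K)%N) (hK01 : (1 <= K0)%N)
    (hK : (K0 <= K)%N) (hN : (K0 < N)%N)
    (I : cbmai R L K) (hr : 0 < sigma_r I) (hc : 0 < sigma_c I)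
    (xstar : 'cV[R]_(K + L)) (hopt : lp_unique_optimal I xstar)
    (hsupp : #|supp xstar| == (L + 1)%N)
    (d : measure_display) (T : measurableType d) (P : probability T R)
    (rw : 'I_K -> nat -> {RV P >-> R})
    (co : 'I_L -> 'I_K -> nat -> {RV P >-> R})
    (hmodel : sample_model I rw co)
    (Xsfsr : T -> option {set 'I_(K + L)})
    (hmeas : forall o, measurable (Xsfsr @^-1` [set o]))
    (hrun : forall w, sfsr_output hK I N (fun a t => rw a t w)
                        (fun l a t => co l a t w) (Xsfsr w)),
  let Istar : col_basis L K := exist _ (supp xstar) hsupp in
  (P [set w | Xsfsr w <> Some (supp xstar)] <=
     (C1 * K%:R)%:E *
       expeR (- ((Ntilde R L K0 N)%:E * gap0_sq hK I Istar * (K%:R^-1)%:E)) +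
     (C2 * K%:R ^+ (L + 2)%N)%:E *
       expeR (- \big[mine/+oo]_(2 <= i < K.+1)
                  ((Ntilde R L K0 N)%:E * ordered_gap hK I Istar (i + L)%N ^+ 2 *
                   (i%:R^-1)%:E)))%E].
Proof.
(* A union of two bases has at most [2 * L.+1] columns with [L.+1] coordinates each, and every
   coordinate costs a factor at most 3. The second constant also includes the factor [L.+1 ^ L.+1]
   from counting bases. *)
pose M : R := 3 ^+ (L.+1 * (2 * L.+1)).
have M0 : 0 < M by rewrite exprn_gt0.
exists M, (M * L.+1%:R ^+ L.+1); split => //.
  by rewrite mulr_gt0// exprn_gt0.
move=> K K0 N hK2 hK01 hK hN I hr hc xstar _ hsupp d T P rw co hmodel Xsfsr
  hmeas hrun; cbv zeta; set Istar : col_basis L K := exist _ _ _.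
have KN : (1 <= K0 < N)%N by rewrite hK01.
pose n k := cum_pulls R L K K0 N k.
pose dev w := deviation I (fun a t => rw a t w) (fun l a t => co l a t w).
pose U (J : col_basis L K) := val Istar :|: val J.
pose cond (p : nat * col_basis L K) :=
  (ordered_gap hK I Istar (K.+1 - p.1 + L) ^+ 2 <= gapJ_sq hK I Istar p.2)%E.
pose B0 k := [set w | (gap0_sq hK I Istar <= (dev w (n k) (cost_coords (val Istar)))%:E)%E].
pose B p := [set w | (gapJ_sq hK I Istar p.2 <= (dev w (n p.1) (arm_coords (U p.2)))%:E)%E].
pose ks := iota 1 K.-1.
pose ps := [seq p <- [seq (k, J) | k <- ks, J <- enum {: col_basis L K}] | cond p].
set e0 := expeR _; set e1 := expeR _.
have ksP k : k \in ks -> (0 < k < K)%N.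
  by rewrite mem_iota add1n prednK// (leq_trans _ hK2).
have cardI : #|val Istar| = L.+1 by rewrite (eqP (valP Istar)) addn1.
have tail k (S : {set coord L K}) x y : (0 < k < K)%N -> (#|S| <= L.+1 * (2 * L.+1))%N ->
    (y <= ((n k)%:R / 3)%:E * x)%E ->
    let A := [set w | (x <= (dev w (n k) S)%:E)%E] in
    measurable A /\ (P A <= M%:E * expeR (- y))%E.
  move=> /andP[k0 kK] cS yx A.
  have nk0 : (0 < n k)%N by apply: cum_pulls_gt0 => //; rewrite k0 ltnW.
  have [mA PA] := deviation_tail S x hmodel hr hc nk0; split => //.
  apply: le_trans PA _; apply: lee_pmul; rewrite ?expeR_ge0 ?lee_fin ?exprn_ge0//.
    by rewrite /M ler_weXn2l// ler1n.
  by rewrite lee_expeR leeN2.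
have gap0_ge0 : (0 <= gap0_sq hK I Istar)%E.
  rewrite mule_ge0 ?lee_fin ?invr_ge0 ?sqr_ge0//.
  apply: le_ereal_inf_tmp => _ [ct [_ ->]]; rewrite lee_fin.
  by rewrite sumr_ge0// => *; rewrite sumr_ge0// => *; exact: sqr_ge0.
have [k_|mB0 PB0] := @finite_union_bound _ _ _ P _ ks B0 (M%:E * e0)%E.
  move=> /ksP kK; apply: tail => //.
    by rewrite (leq_trans (card_cost_coords _))// cardI leq_mul2l /= leq_pmull.
  rewrite muleAC -EFinM; apply: lee_wpmul2r => //.
  rewrite lee_fin Ntilde_le_cum_pulls//; last by lia.
  by case/andP: kK => k0 /ltnW ->; rewrite k0.
have [p|mB PB] := @finite_union_bound _ _ _ P _ ps B (M%:E * e1)%E.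
  rewrite mem_filter => /andP[cp /allpairsP[[k J] [/= /ksP kK _ pE]]].
  rewrite pE in cp *; rewrite /cond /= in cp; apply: tail => //.
    rewrite (leq_trans (card_arm_coords _))// leq_mul2l /=.
    by rewrite (leq_trans (leq_card_setU _ _))// cardI (eqP (valP J)); lia.
  (* As [k] runs over the rounds 1 to [K - 1], this [i] stays between 2 and [K], so its term bounds
     the minimum from above. *)
  set i := (K.+1 - k)%N in cp.
  apply: (@bigmin_inf_seq _ _ _ _ _ i) => //; first by rewrite mem_index_iota; lia.
  rewrite muleAC -EFinM; apply: lee_pmul => //.
  - by rewrite lee_fin mulr_ge0 ?invr_ge0// Ntilde_ge0.
  - by rewrite sqre_ge0.
  rewrite lee_fin Ntilde_le_cum_pulls//.
  by case/andP: kK => k0 /ltnW ->; rewrite k0.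
have mX : measurable [set w | Xsfsr w <> Some (supp xstar)].
  exact: measurableC (hmeas (Some (supp xstar))).
have sub : [set w | Xsfsr w <> Some (supp xstar)] `<=`
    \big[setU/set0]_(k <- ks) B0 k `|` \big[setU/set0]_(p <- ps) B p.
  move=> w /= bad; apply: contrapT => /not_orP[nB0 nB]; apply: bad.
  apply: (sfsr_correct (Istar := Istar) KN _ (hrun w)) => k kK; split.
    rewrite ltNge; apply/negP => Bk; apply: nB0; rewrite -bigcup_seq.
    by exists k => //=; rewrite mem_iota; lia.
  move=> J condJ; rewrite ltNge; apply/negP => Bk; apply: nB; rewrite -bigcup_seq.
  exists (k, J) => //=; rewrite mem_filter; apply/andP; split => //.
  by apply/allpairsP; exists (k, J); rewrite /= mem_enum mem_iota; split => //; lia.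
apply: (le_trans (le_measure P _ _ sub)); rewrite ?inE//; first exact: measurableU.
apply: le_trans (measureU2 _ _ _) _ => //; apply: leeD.
  apply: le_trans PB0 _; rewrite muleA -EFinM; apply: lee_wpmul2r; first exact: expeR_ge0.
  by rewrite lee_fin mulrC ler_pM2l// ler_nat size_iota; lia.
apply: le_trans PB _; rewrite muleA -EFinM; apply: lee_wpmul2r; first exact: expeR_ge0.
rewrite lee_fin mulrC -mulrA ler_pM2l// -!natrX -natrM ler_nat.
rewrite size_filter (leq_trans (count_size _ _))// size_allpairs size_iota -cardT.
(* Fewer than [K] rounds times the number of bases: this is where the power [L + 2] of [K] comes
   from. *)
apply: (@leq_trans (K * (L.+1 * K) ^ L.+1)).
  by rewrite leq_mul ?leq_pred// card_col_basis// (leq_trans _ hK2).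
by rewrite expnMn mulnCA addn2 -expnS.
Qed.
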